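(* For any pair of positive integers $k,n$ with $n \geq k+2$, we have \[ \frac{1}{2}\log(n-k+1) \leq \mathrm{sinv}'_k(n) \leq \log n + 4k - 3 . \]
   Context: All logarithms are to base 2. A digraph has no loops and no parallel arcs but may contain digons (pairs of opposite arcs between the same two vertices). For a digraph $D$ and $X \subseteq V(D)$, inverting $X$ means reversing the direction of every arc of $D$ with both endvertices in $X$; for a family $(X_i)_{i\in I}$ of vertex subsets, $\mathrm{Inv}(D;(X_i)_{i\in I})$ denotes the digraph obtained by inverting the $X_i$ one after another (equivalently, reversing exactly those arcs whose two endvertices lie together in an odd number of the $X_i$). A digraph $D$ is $k$-arc-strong if for every partition $(V_1,V_2)$ of $V(D)$ into nonempty sets there are at least $k$ arcs with tail in $V_1$ and head in $V_2$. $\mathrm{sinv}'_k(D)$ is the minimum number of sets whose inversion transforms $D$ into a $k$-arc-strong digraph. A digraph is $2k$-edge-connected if its underlying undirected multigraph (obtained by forgetting arc orientations, so a digon yields two parallel edges) is $2k$-edge-connected. $\mathrm{sinv}'_k(n) = \max\{\mathrm{sinv}'_k(D) : D \text{ is a } 2k\text{-edge-connected digraph of order } n\}$. *)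

(* Defs.v *)
From Stdlib Require Import Reals.
From mathcomp Require Import all_boot.

Set Implicit Arguments.
Unset Strict Implicit.
Unset Printing Implicit Defensive.

(* A digraph of order n: vertex set 'I_n, arc relation D (D u v = arc u -> v).
   Loopless: irreflexive D.  No parallel arcs (automatic for a relation);
   digons allowed (D u v && D v u). *)
Definition loopless (n : nat) (D : rel 'I_n) : Prop := forall v, D v v = false.

Definition narcs (n : nat) (D : rel 'I_n) (A B : {set 'I_n}) : nat :=
  #|[set p : 'I_n * 'I_n | [&& D p.1 p.2, p.1 \in A & p.2 \in B]]|.

Definition inv_family (n : nat) (D : rel 'I_n) (Xs : seq {set 'I_n}) : rel 'I_n :=
  fun u v => if odd (count (fun X : {set 'I_n} => (u \in X) && (v \in X)) Xs) then D v u else D u v.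

Definition arc_strong (n k : nat) (D : rel 'I_n) : Prop :=
  forall V1 : {set 'I_n}, V1 != set0 -> ~: V1 != set0 -> k <= narcs D V1 (~: V1).

(* underlying undirected multigraph is m-edge-connected: every cut
   (V1, V2) with both sides nonempty is crossed by at least m edges
   (a digon contributes two parallel edges). *)
Definition edge_connected (n m : nat) (D : rel 'I_n) : Prop :=
  forall V1 : {set 'I_n}, V1 != set0 -> ~: V1 != set0 ->
    m <= narcs D V1 (~: V1) + narcs D (~: V1) V1.

Definition is_sinv_digraph (n k : nat) (D : rel 'I_n) (s : nat) : Prop :=
  (exists Xs : seq {set 'I_n}, size Xs = s /\ arc_strong k (inv_family D Xs)) /\
  (forall Xs : seq {set 'I_n}, arc_strong k (inv_family D Xs) -> s <= size Xs).

Definition is_sinv_order (k n s : nat) : Prop :=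
  (forall D : rel 'I_n, loopless D -> edge_connected (2 * k) D ->
     exists t, is_sinv_digraph k D t /\ t <= s) /\
  (exists D : rel 'I_n, loopless D /\ edge_connected (2 * k) D /\ is_sinv_digraph k D s).

Definition log2 (x : R) : R := Rdiv (ln x) (ln (IZR 2%Z)).

(* Main.v *)
Require Import Defs.
From Stdlib Require Import Reals Lra Classical.
From mathcomp Require Import all_boot zify.

Set Implicit Arguments.
Unset Strict Implicit.
Unset Printing Implicit Defensive.

(* Upper bound.  Let H be the arcs of D outside digons, pruned to a minimal set
   that still gives a 2k-edge-connected multigraph together with the digons.
   Splitting off vertices of degree 2k (Lovasz) yields a multiset M of extra
   edges with d_M(X) <= d(X) - 2k for every cut and such that all degrees of
   H + M are even; an Eulerian orientation of H + M restricts to an orientation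
   O of H which is k-arc-strong together with the digons.  It remains to find
   vectors x_v in F_2^s with x_u . x_v prescribed on the edges of H.  They are
   chosen one vertex at a time, keeping the vectors of the placed neighbours of
   every unplaced vertex independent.  By uncrossing, a tight set X meeting the
   remaining vertex set S minimally induces no edge of H in S, and as only 2k
   edges leave X, removing from S a vertex of least degree in X :&: S gives an
   order in which few vectors are forbidden at each step.

   Lower bound.  Take vertices v_1, ..., v_m, and for each pair a vertex w_ij
   dominated by v_i and v_j, plus k - 1 vertices joined to everything by
   digons.  After the inversions w_ij is neither a source nor a sink, so v_i
   and v_j lie in different subfamilies of the inverted sets; and v_i is no
   source, so it lies in at least one of them.  Hence m + 1 <= 2^s. *)

(** * Cuts of edge lists *)

Section Cuts.
Variable T : finType.
Implicit Types (X Y A : {set T}) (E M : seq (T * T)) (e f : T * T) (u v z : T).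

(** Ordered pairs stand for undirected edges: [crosses] does not distinguish the endvertices, and
    repetitions in a list are parallel edges. *)
Definition crosses X : pred (T * T) := fun e => (e.1 \in X) (+) (e.2 \in X).
Definition cut E X := count (crosses X) E.

Lemma cut_cons e E X : cut (e :: E) X = crosses X e + cut E X.
Proof. by []. Qed.

Lemma cut_cat E1 E2 X : cut (E1 ++ E2) X = cut E1 X + cut E2 X.
Proof. exact: count_cat. Qed.

Lemma perm_cut E1 E2 X : perm_eq E1 E2 -> cut E1 X = cut E2 X.
Proof. by move=> /permP/(_ (crosses X)). Qed.

Lemma cutC E X : cut E (~: X) = cut E X.
Proof. by apply: eq_count => e; rewrite /crosses !inE addNb addbN negbK. Qed.

Ltac cut_pointwise E :=
  elim: E => [//|[? ?] E]; rewrite !cut_cons /crosses !inE /=;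
  repeat match goal with |- context [?x \in ?Z] => case: (x \in Z) end;
  rewrite /=; lia.

Lemma cut_submod E X Y :
  cut E (X :&: Y) + cut E (X :|: Y) <= cut E X + cut E Y.
Proof. cut_pointwise E. Qed.

Lemma cut_posimod E X Y :
  cut E (X :\: Y) + cut E (Y :\: X) <= cut E X + cut E Y.
Proof. cut_pointwise E. Qed.

(* An edge joining [X :&: Y] to the outside of [X :|: Y] is counted twice on
   the right and not at all on the left. *)
Lemma cut_posimod_edge E X Y u z :
    ((u, z) \in E) || ((z, u) \in E) ->
    u \in X -> u \in Y -> z \notin X -> z \notin Y ->
  cut E (X :\: Y) + cut E (Y :\: X) + 2 <= cut E X + cut E Y.
Proof.
move=> uzE uX uY /negbTE zX /negbTE zY.
have [F pE] : exists F, perm_eq E ((u, z) :: F) \/ perm_eq E ((z, u) :: F).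
  by case/orP: uzE => /perm_to_rem pE; eexists; [left|right]; exact: pE.
have := cut_posimod F X Y.
by case: pE => pE; rewrite !(perm_cut _ pE) !cut_cons /crosses !inE /= uX uY zX
  zY /=; lia.
Qed.

(** Modulo 2 a cut is the sum of the degrees on one side, hence additive over disjoint unions. *)
Lemma odd_cutD E X Y :
  odd (cut E (X :\: Y)) = odd (cut E X) (+) odd (cut E (X :&: Y)).
Proof.
elim: E => [|[a b] E IH]; first by [].
rewrite !cut_cons !oddD IH /crosses !inE /= !oddb.
by do !case: (_ \in _) => //=; case: odd => //=; case: odd.
Qed.

Lemma odd_cutU1 E X z : z \notin X ->
  odd (cut E (z |: X)) = odd (cut E X) (+) odd (cut E [set z]).
Proof.
move=> zX; elim: E => [|[a b] E IH]; first by [].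
rewrite !cut_cons !oddD IH /crosses !inE /= !oddb.
case: (a =P z) => [->|_]; case: (b =P z) => [->|_]; rewrite ?(negbTE zX) /=;
by do ?case: (_ \in _) => //=; case: odd => //=; case: odd.
Qed.

Definition edges_in A E :=
  all (fun e => [&& e.1 \in A, e.2 \in A & e.1 != e.2]) E.

Definition separates X A := (X :&: A != set0) && (A :\: X != set0).

(** Only cuts between vertices of [A] matter; with [A :\ z] for [A] this is the connectivity that
    splitting off at [z] must preserve. *)
Definition connected_on K A E := forall X, separates X A -> K <= cut E X.

Lemma separatesC X A : separates (~: X) A = separates X A.
Proof.
by rewrite /separates andbC !setDE setCK [A :&: X]setIC [~: X :&: A]setIC.
Qed.

Lemma eq_cut_in A E X Y : edges_in A E -> X :&: A = Y :&: A ->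
  cut E X = cut E Y.
Proof.
move=> /allP EA /setP XY; apply: eq_in_count => e /EA /and3P[e1 e2 _].
by have := (XY e.1, XY e.2); rewrite /crosses !inE e1 e2 !andbT => -[-> ->].
Qed.

Lemma cut_not_separated A E X : edges_in A E -> ~~ separates X A ->
  cut E X = 0.
Proof.
move=> EA; rewrite negb_and !negbK => /orP[/eqP XA|/eqP AX].
  rewrite (@eq_cut_in A E X set0) ?XA ?set0I //.
  by elim: E {EA} => // e E IH; rewrite cut_cons IH /crosses !inE.
rewrite (@eq_cut_in A E X setT).
- by elim: E {EA} => // e E IH; rewrite cut_cons IH /crosses !inE.
- exact: EA.
- by rewrite setTI; apply/setIidPr; rewrite -setD_eq0 AX.
Qed.

Lemma edges_in_rem A E e : edges_in A E -> edges_in A (rem e E).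
Proof. by move=> /allP EA; apply/allP=> f /mem_rem /EA. Qed.

Lemma separates_proper X A : X != set0 -> X \proper A -> separates X A.
Proof.
move=> X0 /properP[XA [a aA aX]]; rewrite /separates (setIidPl XA) X0.
by apply/set0Pn; exists a; rewrite inE aX.
Qed.

(** * Splitting off *)

Section Splitting.
Variables (K : nat) (A : {set T}) (z u : T) (E : seq (T * T)).
Hypotheses (K_even : ~~ odd K) (EA : edges_in A E).
Hypothesis conE : connected_on K (A :\ z) E.
Hypothesis z_even : ~~ odd (cut E [set z]).

(* Sets preventing the split of the edge [zu] with an edge [zv], [v] in [X]. *)
Definition dangerous X :=
  [&& X \proper A :\ z, u \in X & cut E X <= K.+1].

(** If neither set contains the other, the edge [uz] makes posimodularity tight: both cuts are
    [K.+1] and both differences have cut [K]. By parity the intersection has cut above [K], so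
    submodularity bounds the union. *)
Lemma dangerousU X Y : ((u, z) \in E) || ((z, u) \in E) ->
  dangerous X -> dangerous Y -> dangerous (X :|: Y).
Proof.
move=> uzE dX dY.
have [XY|nXY] := boolP (X \subset Y); first by rewrite (setUidPr XY).
have [YX|nYX] := boolP (Y \subset X); first by rewrite (setUidPl YX).
case/and3P: dX => pX uX cX; case/and3P: dY => pY uY cY.
have zX : z \notin X.
  by apply/negP => /(subsetP (proper_sub pX)); rewrite !inE eqxx.
have zY : z \notin Y.
  by apply/negP => /(subsetP (proper_sub pY)); rewrite !inE eqxx.
have h1 : K <= cut E (X :\: Y).
  apply/conE/separates_proper; first by rewrite setD_eq0.
  exact: sub_proper_trans (subsetDl _ _) pX.
have h2 : K <= cut E (Y :\: X).
  apply/conE/separates_proper; first by rewrite setD_eq0.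
  exact: sub_proper_trans (subsetDl _ _) pY.
have h3 : K <= cut E (X :&: Y).
  apply/conE/separates_proper; first by apply/set0Pn; exists u; rewrite inE uX.
  exact: sub_proper_trans (subsetIl _ _) pX.
have h4 := cut_posimod_edge uzE uX uY zX zY.
have [eX eD eD'] : [/\ cut E X = K.+1, cut E (X :\: Y) = K
  & cut E (Y :\: X) = K].
  by move: h1 h2 h4 cX cY; clear => *; split; lia.
have oI : odd (cut E (X :&: Y)).
  by have := odd_cutD E X Y; rewrite eX eD /=; case: odd K_even => //=; case: odd.
have h5 : K < cut E (X :&: Y).
  rewrite ltn_neqAle h3 andbT; apply: contraNneq K_even => ->; exact: oI.
have h6 := cut_submod E X Y.
rewrite /dangerous properEneq !inE uX /= subUset !proper_sub //= andbT.
apply/andP; split; last first.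
  by move: h5 h6 cX cY; clear; lia.
(* If the union were [A :\ z], then [z |: X] would be the complement of [Y :\: X] in [A], with even
   cut [K], although [cut E X] is odd and [z] has even degree. *)
apply: contra K_even => /eqP XYA.
have <- : cut E (z |: X) = K.
  rewrite -eD' -cutC; apply: (eq_cut_in EA); apply/setP => x.
  move/setP: XYA => /(_ x); rewrite !inE.
  by case: (x =P z) => [-> _|_]; rewrite ?(negbTE zY) ?andbF //= => <-;
    case: (x \in X) => //=; case: (x \in Y).
by rewrite odd_cutU1 // eX (negbTE z_even) /= (negbTE K_even).
Qed.

End Splitting.

Lemma cut_setU1 E X z : z \notin X ->
  cut E (z |: X) + cut E [set z] <=
    cut E X + 2 * count (fun e => crosses [set z] e && ~~ crosses X e) E.
Proof.
move=> /negbTE zX; elim: E => [//|[a b] E IH].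
rewrite !cut_cons /= /crosses !inE /=.
move: IH; set c := count _ _; move: c (cut _ _) (cut _ _) (cut _ _).
case: (a =P z) => [->|_]; case: (b =P z) => [->|_]; rewrite ?zX /=;
  case: (a \in X); case: (b \in X); clear; rewrite /=; lia.
Qed.

Lemma crosses_set1 z e : crosses [set z] e ->
  exists2 v, v != z & e = (z, v) \/ e = (v, z).
Proof.
case: e => a b; rewrite /crosses !inE /=.
have [->|az] := eqVneq a z; last first.
  by have [->|//] := eqVneq b z => _; exists a => //; right.
by have [//|bz] := eqVneq b z => _; exists b => //; left.
Qed.

(** Unions of dangerous sets are dangerous, so a largest one, if any exists, contains all the
    others. An edge from [z] to its outside can be split off together with [zu]. *)
Lemma split_once K A z E : ~~ odd K -> edges_in A E -> z \in A ->
    connected_on K (A :\ z) E -> ~~ odd (cut E [set z]) ->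
    0 < cut E [set z] ->
  exists E', [/\ edges_in A E', connected_on K (A :\ z) E',
    cut E [set z] = cut E' [set z] + 2 &
    forall X, z \notin X -> cut E' X <= cut E X /\
                            odd (cut E' X) = odd (cut E X)].
Proof.
move=> K_even EA zA conE z_even z_pos.
have /hasP[e eE /crosses_set1[u uz eq_e]] : has (crosses [set z]) E.
  by rewrite has_count.
have uzE : ((u, z) \in E) || ((z, u) \in E).
  by case: eq_e eE => -> ->; rewrite ?orbT.
have uA : u \in A.
  by move/allP: EA => /(_ e eE); case: eq_e => -> /and3P[].
have pe := perm_to_rem eE.
have [f [f_in f_z f_dang]] : exists f, [/\ f \in rem e E, crosses [set z] f &
  forall X, dangerous K A z u E X -> ~~ crosses X f].
  case: (pickP (dangerous K A z u E)) => [X0 dX0|no_dang]; last first.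
    have : has (crosses [set z]) (rem e E).
      rewrite has_count -/(cut _ _).
      move: z_even z_pos; rewrite (perm_cut _ pe) cut_cons.
      by case: (crosses _ e); case: (cut (rem e E) _).
    by case/hasP => f fE fz; exists f; split => // X; rewrite no_dang.
  case: (@arg_maxnP _ X0 (dangerous K A z u E) (fun X => #|X|) dX0) => X dX maxX.
  have /and3P[pX uX cX] := dX.
  have zX : z \notin X.
    by apply/negP => /(subsetP (proper_sub pX)); rewrite !inE eqxx.
  have sep : separates (z |: X) (A :\ z).
    have /properP[XA [a aA aX]] := pX.
    apply/andP; split; apply/set0Pn; [exists u|exists a].
      by rewrite !inE uX uA uz orbT.
    by move: aA; rewrite !inE (negbTE aX) orbF => /andP[-> ->].
  (* The cut of [z |: X] is at least [K], that of [X] at most [K.+1], and [z] has degree at least 2,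
     so some edge joins [z] to the outside of [X]. *)
  have h := cut_setU1 E zX; have hK := conE _ sep.
  have /hasP[f fE /andP[fz fX]] :
      has (fun e => crosses [set z] e && ~~ crosses X e) E.
    have z2 : 1 < cut E [set z] by case: (cut E [set z]) z_even z_pos => [|[]].
    by rewrite has_count; move: h hK z2 cX; clear; lia.
  exists f; split=> [|//|Y dY].
    move: fE; rewrite (perm_mem pe) inE => /orP[/eqP fe|//]; move: fX.
    by rewrite fe /crosses; case: eq_e => -> /=; rewrite uX (negbTE zX).
  have /and3P[pY uY _] := dY.
  have zY : z \notin Y.
    by apply/negP => /(subsetP (proper_sub pY)); rewrite !inE eqxx.
  have dXY := dangerousU K_even EA conE z_even uzE dX dY.
  have /eqP XU : X == X :|: Y.
    by rewrite eqEcard subsetUl; apply: maxX.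
  have YX : Y \subset X by rewrite XU subsetUr.
  case/crosses_set1: fz fX => v _ [] ->; rewrite /crosses /= (negbTE zX)
    (negbTE zY) /= ?addbF; exact: contra (subsetP YX v).
have [v vz eq_f] := crosses_set1 f_z.
have pf := perm_to_rem f_in; set E2 := rem f _ in pf.
have pE : perm_eq E (e :: f :: E2).
  by apply: perm_trans pe _; rewrite perm_cons.
have EA' : edges_in A (e :: f :: E2) by rewrite /edges_in -(perm_all _ pE).
have vA : v \in A.
  by case/and3P: EA' => _ + _; case: eq_f => -> /and3P[].
have cutE X : z \notin X -> cut E X = (u \in X) + ((v \in X) + cut E2 X).
  move=> /negbTE zX; rewrite (perm_cut _ pE) !cut_cons /crosses.
  by case: eq_e => ->; case: eq_f => ->; rewrite /= zX ?addbF.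
(* For [u = v] the new edge would be a loop, which [edges_in] excludes. *)
pose E' := if u == v then E2 else (u, v) :: E2.
have cutE' X : cut E' X = ((u \in X) (+) (v \in X)) + cut E2 X.
  by rewrite /E'; case: eqP => [->|_]; rewrite ?addbb // cut_cons.
exists E'; split.
- case/and3P: EA' => _ _ EA2; rewrite /E'; case: eqVneq => //= uv.
  by rewrite uA vA uv.
- suff conE' X : z \notin X -> separates X (A :\ z) -> K <= cut E' X.
    move=> X sX; have [zX|zX] := boolP (z \in X); last exact: conE'.
    by rewrite -cutC; apply: conE'; rewrite ?separatesC // inE zX.
  move=> zX sX; have := conE _ sX; rewrite cutE // cutE'.
  have [uX|uX] := boolP (u \in X); have [vX|vX] := boolP (v \in X);
    rewrite /= => hK; rewrite //.
  (* Only a set holding both [u] and [v] loses crossing edges, namely two. Falling below [K] would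
     make it dangerous, against the choice of [f]. *)
  rewrite leqNgt; apply/negP => lt.
  have dX : dangerous K A z u E (X :&: (A :\ z)).
    apply/and3P; split; last 1 first.
    - rewrite (eq_cut_in (Y := X) EA) ?cutE // ?uX ?vX.
        by move: lt; clear; lia.
      apply/setP => x; rewrite !inE; case: (x =P z) => [->|_].
        by rewrite (negbTE zX).
      by case: (x \in X) => //=; case: (x \in A).
    - rewrite properEneq subsetIr andbT.
      apply: contraTneq sX => h; rewrite /separates -{2}h setDIl setDv set0I.
      by rewrite eqxx andbF.
    - by rewrite !inE uX uA uz.
  have := f_dang _ dX; rewrite /crosses.
  by case: eq_f => -> /=; rewrite !inE vX vA vz eqxx ?(negbTE zX).
- rewrite (perm_cut _ pE) !cut_cons cutE' !inE (negbTE uz) (negbTE vz) /=.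
  rewrite f_z; case: eq_e => ->; rewrite /crosses /= !inE eqxx (negbTE uz) /=;
  clear; lia.
- move=> X zX; rewrite cutE // cutE' !oddD; split.
    by case: (u \in X); case: (v \in X); rewrite /=; clear; lia.
  by case: (u \in X); case: (v \in X); rewrite /= ?negbK.
Qed.

(** Splitting is repeated until [z] is isolated. As no cut grows and parities are kept, a parity
    correction of the new graph also serves the old one. *)
Lemma split_off K A z E : ~~ odd K -> edges_in A E -> z \in A ->
    connected_on K (A :\ z) E -> ~~ odd (cut E [set z]) ->
  exists E', [/\ edges_in (A :\ z) E', connected_on K (A :\ z) E' &
    forall X, z \notin X -> cut E' X <= cut E X /\
                            odd (cut E' X) = odd (cut E X)].
Proof.
move=> K_even; have [d] := ubnP (cut E [set z]).
elim: d E => // d IH E led EA zA conE z_even.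
have [z0|z_pos] := posnP (cut E [set z]).
  exists E; split => //; apply/allP => e eE.
  have /and3P[e1 e2 e12] := allP EA _ eE.
  rewrite !inE e1 e2 e12 /= !andbT -negb_or.
  apply/negP => e_z; have : has (crosses [set z]) E.
    apply/hasP; exists e => //; rewrite /crosses !inE.
    case/orP: e_z => /eqP <-; rewrite eqxx ?addbT ?addTb //.
    by rewrite eq_sym.
  by rewrite has_count -/(cut _ _) z0.
have [E1 [E1A conE1 cut1 leE1]] := split_once K_even EA zA conE z_even z_pos.
case: (IH E1) => //.
- by move: led cut1; clear; lia.
- by move: z_even; rewrite cut1 oddD addbF.
move=> E' [E'A conE' leE']; exists E'; split => // X zX.
have [le1 o1] := leE1 X zX; have [le2 o2] := leE' X zX.
by split; [exact: leq_trans le2 le1 | rewrite o2].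
Qed.

Lemma cut_set1_setD1 E X z : z \in X ->
  cut E [set z] + cut E (X :\ z) <= cut E X +
    2 * count (fun e => [&& e.1 \in X, e.2 \in X & crosses [set z] e]) E.
Proof.
move=> zX; elim: E => [//|[a b] E IH].
rewrite !cut_cons /= /crosses !inE /=.
move: IH; set c := count _ _; move: c (cut _ _) (cut _ _) (cut _ _).
case: (a =P z) => [->|_]; case: (b =P z) => [->|_]; rewrite ?zX /=;
  case: (a \in X); case: (b \in X); clear; rewrite /=; lia.
Qed.

(** Uncrossing shows that a smallest tight set [X] is a singleton. Otherwise it spans an edge, which
    crosses a tight set [Y], and either [Y] or, by posimodularity, [X :\: Y] is tight and
    smaller. *)
Lemma min_degree_vertex K A E : 0 < K -> edges_in A E -> connected_on K A E ->
    1 < #|A| ->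
    (forall e, e \in E ->
      exists X, [/\ separates X A, crosses X e & cut E X = K]) ->
  exists2 z, z \in A & cut E [set z] = K.
Proof.
move=> K_gt0 EA conE A_gt1 tightE.
pose P X := [&& X \proper A, X != set0 & cut E X == K].
have tightP e : e \in E -> exists2 X, P X & crosses X e.
  move=> eE; have [X [sX eX cX]] := tightE e eE; exists (X :&: A).
    apply/and3P; split.
    - case/andP: sX => _ /set0Pn[a]; rewrite inE => /andP[aX aA].
      apply/properP; split; first exact: subsetIr.
      by exists a; rewrite // inE (negbTE aX).
    - by case/andP: sX.
    - by rewrite -cX (eq_cut_in (Y := X) EA) // -setIA setIid.
  by have /and3P[e1 e2 _] := allP EA _ eE; rewrite /crosses !inE e1 e2 !andbT.
have [X0 PX0] : exists X, P X.
  have [a aA] : exists a, a \in A by apply/card_gt0P; exact: ltnW.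
  have /conE : separates [set a] A.
    apply: separates_proper; first by apply/set0Pn; exists a; rewrite inE.
    by rewrite properEcard sub1set aA cards1.
  move/(leq_trans K_gt0); rewrite -has_count => /hasP[e eE _].
  by have [X PX _] := tightP e eE; exists X.
case: (@arg_minnP _ X0 P (fun X => #|X|) PX0) => X PX minX.
have /and3P[pX X0' /eqP cX] := PX; have /set0Pn[z zX] := X0'.
have zA : z \in A by exact: subsetP (proper_sub pX) z zX.
exists z => //; suff -> : [set z] = X by [].
apply/eqP; rewrite eqEsubset sub1set zX -setD_eq0 -[_ == _]negbK; apply/negP.
move=> Xz.
have h1 : K <= cut E [set z].
  apply/conE/separates_proper; first by apply/set0Pn; exists z; rewrite inE.
  by apply: sub_proper_trans pX; rewrite sub1set.
have h2 : K <= cut E (X :\ z).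
  apply/conE/separates_proper => //.
  by apply: sub_proper_trans pX; rewrite subD1set.
have h3 := cut_set1_setD1 E zX.
have /hasP[e eE /and3P[e1 e2 _]] :
    has (fun e => [&& e.1 \in X, e.2 \in X & crosses [set z] e]) E.
  by rewrite has_count; move: h1 h2 h3 cX K_gt0; clear; lia.
have [Y PY eY] := tightP e eE; have /and3P[pY Y0 /eqP cY] := PY.
have [w1 [w2 [w1X w2X w1Y w2Y]]] :
    exists w1 w2, [/\ w1 \in X, w2 \in X, w1 \in Y & w2 \notin Y].
  move: eY; rewrite /crosses; have [y1|y1] := boolP (e.1 \in Y) => /= y2.
    by exists e.1, e.2.
  by exists e.2, e.1.
have [YX|nYX] := boolP (Y \subset X).
  have /minX := PY; rewrite leqNgt => /negP; apply; apply: proper_card.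
  by apply/properP; split => //; exists w2.
have pXY : P (X :\: Y).
  have pD : X :\: Y \proper A by apply: sub_proper_trans (subsetDl _ _) pX.
  have nD : X :\: Y != set0 by apply/set0Pn; exists w2; rewrite inE w2Y.
  have k1 : K <= cut E (X :\: Y) by apply/conE/separates_proper.
  have k2 : K <= cut E (Y :\: X).
    apply/conE/separates_proper; first by rewrite setD_eq0.
    exact: sub_proper_trans (subsetDl _ _) pY.
  apply/and3P; split => //; apply/eqP.
  by have := cut_posimod E X Y; move: k1 k2 cX cY; clear; lia.
have /minX := pXY; rewrite leqNgt => /negP; apply; apply: proper_card.
by apply/properP; split; [exact: subsetDl | exists w1; rewrite ?inE // w1Y].
Qed.

Lemma separates_card X A : separates X A -> 1 < #|A|.
Proof.
case/andP => /set0Pn[a]; rewrite inE => /andP[aX aA] /set0Pn[b].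
rewrite inE => /andP[bX bA]; apply/card_gt1P; exists a, b; split=> //.
by apply: contraNneq bX => <-.
Qed.

(** Induction on vertices, then edges. An edge whose removal preserves connectivity moves into [M];
    when none is left, some vertex has degree [K] and is split off. *)
Lemma parity_correction K A E :
    ~~ odd K -> 0 < K -> edges_in A E -> connected_on K A E ->
  exists M, [/\ edges_in A M, forall X, ~~ odd (cut E X + cut M X) &
    forall X, separates X A -> cut M X + K <= cut E X].
Proof.
move=> K_even K_gt0; have [c] := ubnP #|A|; elim: c A E => // c IHA A E leA.
have [d] := ubnP (size E); elim: d E => // d IHE E led EA conE.
have [A_le1|A_gt1] := leqP #|A| 1.
  exists E; split=> [//|X|X /separates_card]; last by rewrite ltnNge A_le1.
  by rewrite oddD addbb.
have [/hasP[e eE /forallP conE']|/hasPn noE] := boolP (has (fun e =>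
  [forall X, separates X A ==> (K <= cut (rem e E) X)]) E).
  have pe := perm_to_rem eE.
  case: (IHE (rem e E)) => [|||M [MA oM leM]].
  - rewrite size_rem //; case: (E) eE led => // e0 E0 _ /=; clear; lia.
  - exact: edges_in_rem.
  - by move=> X; apply/implyP.
  exists (e :: M); split=> [|X|X sX].
  - by rewrite /edges_in /= (allP EA _ eE).
  - rewrite (perm_cut _ pe) !cut_cons addnACA addnn oddD odd_double.
    exact: oM.
  - rewrite (perm_cut _ pe) !cut_cons -addnA leq_add2l; exact: leM.
have [z zA cz] : exists2 z, z \in A & cut E [set z] = K.
  apply: min_degree_vertex => // e eE; have := noE e eE.
  rewrite negb_forall => /existsP[X]; rewrite negb_imply -ltnNge => /andP[sX].
  have := conE X sX; rewrite (perm_cut _ (perm_to_rem eE)) cut_cons => le1 lt1.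
  exists X; rewrite (perm_cut _ (perm_to_rem eE)) cut_cons.
  split=> //; first by move: le1 lt1; case: crosses => //=; clear; lia.
  by move: le1 lt1; case: crosses; rewrite /=; clear; lia.
have sep_D1 X : separates X (A :\ z) -> separates X A.
  case/andP => /set0Pn[a]; rewrite !inE => /and3P[aX _ aA] /set0Pn[b].
  rewrite !inE => /and3P[bX _ bA]; apply/andP.
  by split; apply/set0Pn; [exists a|exists b]; rewrite inE ?aX ?bX.
have [E' [E'A conE' leE']] : exists E', [/\ edges_in (A :\ z) E',
    connected_on K (A :\ z) E' & forall X, z \notin X -> cut E' X <= cut E X /\
                            odd (cut E' X) = odd (cut E X)].
  apply: split_off => //; first by move=> X /sep_D1 /conE.
  by rewrite cz.
case: (IHA (A :\ z) E') => [|||M [MA oM leM]] //.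
  by move: leA; rewrite (cardsD1 z A) zA.
exists M; split=> [|X|X sX].
- apply: sub_all MA => e; rewrite !inE.
  by case/and3P => /andP[_ ->] /andP[_ ->] ->.
- suff oX Y : z \notin Y -> ~~ odd (cut E Y + cut M Y).
    have [zX|/oX //] := boolP (z \in X).
    by rewrite -[cut E X]cutC -[cut M X]cutC; apply: oX; rewrite inE zX.
  by move=> /leE'[_ oE]; have := oM Y; rewrite !oddD oE.
- suff leX Y : z \notin Y -> separates Y A -> cut M Y + K <= cut E Y.
    have [zX|zX] := boolP (z \in X); last exact: leX.
    rewrite -[cut E X]cutC -[cut M X]cutC.
    by apply: leX; rewrite ?separatesC // inE zX.
  move=> zY sY; have [sY'|nsY] := boolP (separates Y (A :\ z)).
    exact: leq_trans (leM _ sY') (leE' _ zY).1.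
  (* Here [Y] separates [A] but not [A :\ z], so no edge of [M] crosses it. *)
  by rewrite (cut_not_separated MA nsY); exact: conE.
Qed.

(** * Orientations *)

Definition same_edge : rel (T * T) := fun e f => (f == e) || (f == (e.2, e.1)).

Definition leaves X : pred (T * T) := fun e => (e.1 \in X) && (e.2 \notin X).

Definition orients E F := all2 same_edge E F.

Lemma orients_cut E F X : orients E F ->
  cut E X = count (leaves X) F + count (leaves (~: X)) F.
Proof.
elim: E F => [|e E IH] [|f F] // /andP[ef EF]; rewrite cut_cons (IH F) //=.
rewrite addnACA; congr (_ + _); rewrite /leaves !inE /crosses.
by case/orP: ef => /eqP -> /=; case: (e.1 \in X); case: (e.2 \in X).
Qed.

Lemma orients_cat E1 E2 F : orients (E1 ++ E2) F ->
  exists F1 F2, [/\ F = F1 ++ F2, orients E1 F1 & orients E2 F2].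
Proof.
elim: E1 F => [|e E IH] F /=; first by exists [::], F.
case: F => //= f F /andP[ef /IH[F1 [F2 [-> o1 o2]]]].
by exists (f :: F1), F2; rewrite /orients /= ef.
Qed.

Lemma cat_orients E1 E2 F1 F2 :
  orients E1 F1 -> orients E2 F2 -> orients (E1 ++ E2) (F1 ++ F2).
Proof.
elim: E1 F1 => [|e E IH] [|f F] //= /andP[ef EF] o2.
by rewrite /orients /= ef; apply: IH.
Qed.

(** Induction on the number of edges. An edge [uv] that is no loop meets a second edge [vw], since
    [v] has even degree. Both are replaced by [uw], possibly a loop, whose direction is then routed
    through [v]. *)
Lemma eulerian_orientation E : (forall X, ~~ odd (cut E X)) ->
  exists2 F, orients E F &
    forall X, count (leaves X) F = count (leaves (~: X)) F.
Proof.
have [d] := ubnP (size E); elim: d E => // d IH [|[u v] E] led evenE.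
  by exists [::].
have [uv|uv] := eqVneq u v.
  subst v; case: (IH E) => [//|X|F oF eF].
    by have := evenE X; rewrite cut_cons /crosses addbb.
  exists ((u, u) :: F); first by rewrite /orients /= /same_edge eqxx.
  by move=> X; rewrite /= eF /leaves !inE negbK andbN andNb.
have /hasP[f fE /crosses_set1[w wv eq_f]] : has (crosses [set v]) E.
  have := evenE [set v]; rewrite cut_cons /crosses !inE (negbTE uv) eqxx /=.
  by rewrite has_count -/(cut E [set v]); case: (cut _ _).
case/splitPr: fE led evenE => E1 E2 led evenE.
case: (IH ((u, w) :: E1 ++ E2)) => [|X|G].
- by move: led; rewrite /= !size_cat /= addnS.
- have := evenE X; rewrite !cut_cons !cut_cat cut_cons /crosses !oddD.
  case: eq_f => -> /=; rewrite !oddb; move: (odd _) (odd _).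
    by case: (u \in X); case: (v \in X); case: (w \in X) => // -[] [].
  by case: (u \in X); case: (v \in X); case: (w \in X) => // -[] [].
case: G => [|g G] //= /andP[uwg /orients_cat[F1 [F2 [-> o1 o2]]]] eG.
pose b := g == (u, w).
exists ((if b then (u, v) else (v, u)) :: F1 ++
        (if b then (v, w) else (w, v)) :: F2).
  rewrite /orients /=; apply/andP; split.
    by rewrite /same_edge /=; case: b; rewrite eqxx ?orbT.
  apply: cat_orients => //; rewrite /orients /= -/(orients E2 F2) o2 andbT.
  by rewrite /same_edge; case: eq_f => -> /=; case: b; rewrite eqxx ?orbT.
move=> X; have := eG X; rewrite /= !count_cat /= !(addnCA (count _ F1)).
rewrite {}/b; move: (count _ F1 + _) (count _ F1 + _) => c1 c2.
move: uwg; rewrite /same_edge; case: (eqVneq g (u, w)) => [-> _|_ /= /eqP ->].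
  rewrite /leaves !inE /= !negbK; case: (u \in X); case: (v \in X);
  case: (w \in X) => /=; clear; lia.
rewrite /leaves !inE /= !negbK.
by case: (u \in X); case: (v \in X); case: (w \in X) => /=; clear; lia.
Qed.
End Cuts.

(** * Vectors over the two-element field *)

Section Vectors.
Variable s : nat.
Implicit Types x y w : {ffun 'I_s -> bool}.

Definition dot x y := \big[addb/false]_i (x i && y i).
Definition addv x y : {ffun 'I_s -> bool} := [ffun i => x i (+) y i].
Definition zerov : {ffun 'I_s -> bool} := [ffun=> false].

Lemma dotC x y : dot x y = dot y x.
Proof. by apply: eq_bigr => i _; rewrite andbC. Qed.

Lemma dotDl x y w : dot (addv x y) w = dot x w (+) dot y w.
Proof.
by rewrite /dot -big_split; apply: eq_bigr => i _; rewrite ffunE andb_addl.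
Qed.

Lemma dotDr x y w : dot w (addv x y) = dot w x (+) dot w y.
Proof. by rewrite dotC dotDl ![dot _ w]dotC. Qed.

Lemma addvK y : involutive (addv^~ y).
Proof. by move=> x; apply/ffunP => i; rewrite !ffunE addbK. Qed.

Lemma addvC x y : addv x y = addv y x.
Proof. by apply/ffunP => i; rewrite !ffunE addbC. Qed.

Lemma addv_eq0 x y : (addv x y == zerov) = (x == y).
Proof.
apply/eqP/eqP => [/ffunP h|->]; apply/ffunP => i; last by rewrite !ffunE addbb.
by have := h i; rewrite !ffunE; case: (x i); case: (y i).
Qed.

Section Family.
Variable T : finType.
Implicit Types (z : T -> {ffun 'I_s -> bool}) (I J : {set T}).

Definition vsum z J : {ffun 'I_s -> bool} :=
  [ffun i => \big[addb/false]_(u in J) z u i].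

(** Over the two-element field, linear combinations are sums of subfamilies. *)
Definition vspan z I := [set vsum z J | J in powerset I].

Definition indep z I := forall J, J \subset I -> J != set0 -> vsum z J != zerov.

Lemma vsum0 z : vsum z set0 = zerov.
Proof. by apply/ffunP => i; rewrite !ffunE big_set0. Qed.

Lemma vsumU1 z J u : u \notin J -> vsum z (u |: J) = addv (z u) (vsum z J).
Proof. by move=> uJ; apply/ffunP => i; rewrite !ffunE big_setU1. Qed.

Lemma eq_vsum z1 z2 J : {in J, z1 =1 z2} -> vsum z1 J = vsum z2 J.
Proof.
by move=> h; apply/ffunP => i; rewrite !ffunE; apply: eq_bigr => u /h ->.
Qed.

Lemma card_vspan z I : #|vspan z I| <= 2 ^ #|I|.
Proof. by rewrite -card_powerset leq_imset_card. Qed.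

Lemma zerov_span z I : zerov \in vspan z I.
Proof. by apply/imsetP; exists set0; rewrite ?vsum0 // powersetE sub0set. Qed.

Lemma vspanS z I1 I2 : I1 \subset I2 -> vspan z I1 \subset vspan z I2.
Proof. by move=> I12; apply: imsetS; rewrite powersetS. Qed.

(* If [y1] separates [w] and [y2] separates [w + z v] from the span of the
   other vectors, then [y1], [y2] or [y1 + y2] also vanishes at [z v]. *)
Lemma dual_vector z I w : w \notin vspan z I ->
  exists2 y, {in I, forall u, dot y (z u) = false} & dot y w.
Proof.
have [d] := ubnP #|I|; elim: d I w => // d IH I w leI wI.
have [->|[v vI]] := set_0Vmem I.
  have : w != zerov by apply: contraNneq wI => ->; exact: zerov_span.
  case: (pickP (fun i => w i)) => [i wi _|w0]; last first.
    by case/eqP; apply/ffunP => i; rewrite w0 ffunE.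
  exists [ffun j => j == i]; first by move=> u; rewrite inE.
  rewrite /dot (bigD1 i) //= ffunE eqxx wi big1 // => j /negbTE ji.
  by rewrite ffunE ji.
have cI : #|I :\ v| < d by move: leI; rewrite (cardsD1 v I) vI.
have [|y1 h1 w1] := IH (I :\ v) w cI.
  by apply: contra wI; apply/subsetP/vspanS/subsetDl.
have [|y2 h2 w2] := IH (I :\ v) (addv w (z v)) cI.
  apply: contra wI => /imsetP[J]; rewrite powersetE subsetD1 => /andP[JI vJ] e.
  apply/imsetP; exists (v |: J); first by rewrite powersetE subUset sub1set vI.
  by rewrite vsumU1 // -e addvC addvK.
have ext y : {in I :\ v, forall u, dot y (z u) = false} -> dot y (z v) = false ->
    {in I, forall u, dot y (z u) = false}.
  move=> h hv u uI; have [->//|uv] := eqVneq u v.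
  by apply: h; rewrite !inE uv.
case v1: (dot y1 (z v)); last by exists y1 => //; apply: ext.
move: w2; rewrite dotDr; case v2: (dot y2 (z v)) => w2; last first.
  by exists y2; [apply: ext | rewrite addbF in w2].
exists (addv y1 y2); last by rewrite dotDl w1; case: (dot y2 w) w2.
apply: ext => [u uI|]; first by rewrite dotDl h1 ?h2.
by rewrite dotDl v1 v2.
Qed.

(** Induction on [I]: a vector [y0] orthogonal to the other vectors but not to [z v] exchanges, by
    translation, the two possible products with [z v]. Hence each equation at most halves the
    solution set. *)
Lemma card_solutions z I (a : pred T) : indep z I ->
  2 ^ s <= #|[set y | [forall u in I, dot y (z u) == a u]]| * 2 ^ #|I|.
Proof.
have [d] := ubnP #|I|; elim: d I => // d IH I leI indI.
have [I0|[v vI]] := set_0Vmem I.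
  rewrite I0 cards0 muln1.
  have -> : [set y | [forall u in set0, dot y (z u) == a u]] = setT.
    by apply/setP => y; rewrite !inE; apply/forallP => u; rewrite inE.
  by rewrite cardsT card_ffun card_bool card_ord.
have cI : #|I :\ v| < d by move: leI; rewrite (cardsD1 v I) vI.
have indI' : indep z (I :\ v).
  by move=> J JI; apply: indI; apply: subset_trans JI (subsetDl _ _).
have [|y0 h0 yv] := @dual_vector z (I :\ v) (z v).
  apply/imsetP => -[J]; rewrite powersetE subsetD1 => /andP[JI vJ] e.
  have := indI (v |: J); rewrite subUset sub1set vI JI vsumU1 // addv_eq0 -e eqxx.
  by move=> /(_ isT) h; apply/notF/h/set0Pn; exists v; rewrite !inE eqxx.
apply: leq_trans (IH _ cI indI') _.
rewrite (cardsD1 v I) vI expnS mulnA leq_mul2r; apply/orP; right.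
set S := [set y | _]; set S1 := [set y | _].
have SE y : (y \in S1) = (y \in S) && (dot y (z v) == a v).
  rewrite !inE; apply/forall_inP/andP => [h|[/forall_inP h hv] u uI].
    by split; [apply/forall_inP => u /setD1P[_ /h] | exact: h].
  by have [->//|uv] := eqVneq u v; apply: h; rewrite !inE uv.
have -> : S = S1 :|: [set addv y y0 | y in S1].
  apply/setP => y; rewrite in_setU SE; case yS: (y \in S) => /=; last first.
    apply/esym/imsetP => -[x xS1 e].
    move/negbT: yS; rewrite e inE => /negP; apply; apply/forall_inP => u uI.
    rewrite dotDl h0 // addbF; move: xS1; rewrite SE inE.
    by case/andP => /forall_inP /(_ u uI).
  have [//|ne] := eqVneq (dot y (z v)) (a v); apply/esym/imsetP.
  exists (addv y y0); last by rewrite addvK.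
  rewrite SE dotDl yv; apply/andP; split; last first.
    by move: ne; case: dot; case: (a v).
  move: yS; rewrite !inE => /forall_inP h; apply/forall_inP => u uI.
  by rewrite dotDl h0 // addbF; apply: h.
apply: leq_trans (leq_card_setU _ _) _.
by rewrite muln2 -addnn leq_add2l leq_imset_card.
Qed.

End Family.
End Vectors.

(** * Greedy choice of the vectors *)

(** Bounds the forbidden vectors of a vertex with [l] neighbours, none of them placed. The zero
    vector is common to all the spans and counted once, which the case [k = 1] needs. *)
Lemma count_bound0 k N l : 0 < k -> l.+1 < 2 ^ N.+1 ->
  1 + l * (2 ^ (2 * k - 1) - 1) < 2 ^ (N + 4 * k - 3).
Proof.
case: k => // k _ lN.
have -> : 2 * k.+1 - 1 = (k + k).+1 by lia.
have -> : N + 4 * k.+1 - 3 = N.+1 + ((k + k) + (k + k)) by lia.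
rewrite !expnD expnS; have: 0 < 2 ^ k by rewrite expn_gt0.
rewrite !expnD; move: (2 ^ k) (2 ^ N.+1) lN => a b lb a0.
have: 0 < a * a by rewrite muln_gt0 a0.
move: (a * a) => c c0; clear a a0.
have h : 2 * c - 1 <= c * c by nia.
apply: (@leq_ltn_trans (l.+1 * (c * c))); first by nia.
by rewrite ltn_mul2r lb muln_gt0 c0.
Qed.

(** Here [m] is the size of [X :&: S], [e] the number of exceptional neighbours and [p] the number
    of equations. As [1 < N], the exponent is at least [4 * k - 1], which leaves a factor
    [2 ^ (2 * k - p)] to absorb [e.+1]. *)
Lemma count_bound1 k N m p e : 1 < N -> 0 < m -> 0 < p -> e + m * p <= 2 * k ->
  (2 ^ (m - 1) + e * 2 ^ (2 * k - 1)) * 2 ^ p < 2 ^ (N + 4 * k - 3).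
Proof.
move=> N1 m0 p0 emp.
have k0 : 0 < k by nia.
have pk : p <= 2 * k by nia.
apply: (@leq_trans (2 ^ (2 * k - 1 + (2 * k - p) + p))); last first.
  by rewrite leq_exp2l //; lia.
rewrite expnD ltn_mul2r expn_gt0 /= expnD.
have [mk|mk] := ltnP m (2 * k).
  have h1 : 2 ^ (m - 1) < 2 ^ (2 * k - 1) by rewrite ltn_exp2l //; lia.
  have h2 : e < 2 ^ (2 * k - p) by apply: leq_ltn_trans (ltn_expl _ _) => //; nia.
  apply: (@leq_trans (e.+1 * 2 ^ (2 * k - 1))).
    by rewrite mulSn ltn_add2r.
  by rewrite mulnC leq_mul2l h2 orbT.
have [-> [-> ->]] : e = 0 /\ m = 2 * k /\ p = 1 by nia.
rewrite addn0 ltn_Pmulr ?expn_gt0 //.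
by rewrite -{1}(expn0 2) ltn_exp2l //; lia.
Qed.

Lemma leq_card_bigcup (I T : finType) (P : {pred I}) (F : I -> {set T}) :
  #|\bigcup_(i in P) F i| <= \sum_(i in P) #|F i|.
Proof.
elim/big_rec2: _ => [|i n A _ le]; first by rewrite cards0.
by apply: leq_trans (leq_card_setU _ _) _; rewrite leq_add2l.
Qed.

Section Realize.
Variables (T : finType) (adj : rel T) (k N : nat).
Hypotheses (adj_sym : symmetric adj) (adj_irr : irreflexive adj).

Definition nbr v := [set u | adj v u].

(* The neighbours in [S] of any other neighbour of [v] outside [S] all lie in
   [X :&: S], so the unexceptional neighbours share one small forbidden span. *)
Definition exceptional (S X : {set T}) v :=
  [set w in nbr v :\: S | (w \notin X) || ~~ (nbr w :&: S \subset X)].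

(** The vertex [v] is placed last among those of [S]: [nbr v :&: S] gives the equations on its
    vector, and [nbr v :\: S] the unplaced vertices whose independence it must not spoil. *)
Definition removable (S : {set T}) v :=
  nbr v :&: S = set0 \/
  exists2 X : {set T}, v \in X &
    #|exceptional S X v| + #|X :&: S| * #|nbr v :&: S| <= 2 * k.

Hypotheses (k_gt0 : 0 < k) (N_gt1 : 1 < N) (T_lt : #|T| < 2 ^ N.+1).
Hypothesis elim_order : forall S : {set T}, S != set0 ->
  exists2 v, v \in S & removable S v.

Notation s := (N + 4 * k - 3).

(** The equations at [v] leave at least a fraction [1 / 2 ^ #|nbr v :&: S|] of all vectors, so this
    inequality guarantees a solution outside the forbidden spans. *)
Lemma card_forbidden (z : T -> {ffun 'I_s -> bool}) (S : {set T}) v :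
    v \in S -> removable S v -> (forall w, w \notin S -> #|nbr w :&: S| <= 2 * k) ->
  #|\bigcup_(w in nbr v :\: S) vspan z (nbr w :&: (S :\ v))| *
    2 ^ #|nbr v :&: S| < 2 ^ s.
Proof.
move=> vS remv goodS; set F := \bigcup_(w in _) _.
have card_w w : w \in nbr v :\: S -> #|nbr w :&: (S :\ v)| <= 2 * k - 1.
  rewrite !inE => /andP[wS vw]; have := goodS w wS.
  rewrite (cardsD1 v (nbr w :&: S)) !inE adj_sym vw vS -setIDA; lia.
have span_w w : w \in nbr v :\: S ->
    #|vspan z (nbr w :&: (S :\ v))| <= 2 ^ (2 * k - 1).
  move=> /card_w h; apply: leq_trans (card_vspan _ _) _.
  by rewrite leq_exp2l.
have [p0|p_gt0] := posnP #|nbr v :&: S|.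
  rewrite p0 muln1.
  apply: leq_ltn_trans (count_bound0 (l := #|nbr v|) k_gt0 _); last first.
    apply: leq_ltn_trans T_lt; rewrite -cardsT.
    apply: (@leq_trans #|v |: nbr v|); last exact: subset_leq_card (subsetT _).
    by rewrite cardsU1 inE adj_irr.
  have sub : F \subset zerov s |:
      \bigcup_(w in nbr v :\: S) (vspan z (nbr w :&: (S :\ v)) :\ zerov s).
    apply/subsetP => y /bigcupP[w wv yw]; rewrite !inE.
    have [//|y0] := eqVneq y (zerov s); apply/bigcupP; exists w => //.
    by rewrite !inE y0.
  apply: leq_trans (subset_leq_card sub) _.
  rewrite cardsU1; apply: leq_add; first by case: (_ \notin _).
  apply: (@leq_trans (\sum_(w in nbr v :\: S) (2 ^ (2 * k - 1) - 1))); last first.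
    by rewrite sum_nat_const leq_mul2r subset_leq_card ?subsetDl ?orbT.
  apply: leq_trans (leq_card_bigcup _ _) _.
  apply: leq_sum => w wv; have := span_w w wv.
  by rewrite (cardsD1 (zerov s)) zerov_span; lia.
case: remv => [e|[X vX bound]]; first by rewrite e cards0 in p_gt0.
have m_gt0 : 0 < #|X :&: S| by apply/card_gt0P; exists v; rewrite inE vX.
apply: leq_ltn_trans (count_bound1 N_gt1 m_gt0 p_gt0 bound).
rewrite leq_mul2r; apply/orP; right.
have sub : F \subset vspan z ((X :&: S) :\ v) :|:
    \bigcup_(w in exceptional S X v) vspan z (nbr w :&: (S :\ v)).
  apply/subsetP => y /bigcupP[w wv yw]; rewrite inE.
  have [wE|wE] := boolP (w \in exceptional S X v).
    by apply/orP; right; apply/bigcupP; exists w.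
  apply/orP; left; move: yw; apply/subsetP/vspanS.
  move: wE; rewrite inE wv /= negb_or !negbK => /andP[_ sX].
  by rewrite setIDA setSD // subsetI sX subsetIr.
apply: leq_trans (subset_leq_card sub) _.
apply: leq_trans (leq_card_setU _ _) _; apply: leq_add.
  apply: leq_trans (card_vspan _ _) _; rewrite leq_exp2l //.
  by rewrite (cardsD1 v (X :&: S)) inE vX vS; lia.
apply: leq_trans (leq_card_bigcup _ _) _.
rewrite -sum_nat_const; apply: leq_sum => w; rewrite inE => /andP[wv _].
exact: span_w.
Qed.

(** Independence at the vertices outside [S] is the invariant that makes the linear system of the
    next placed vertex solvable. *)
Lemma realize_on (a : rel T) (S : {set T}) :
    (forall w, w \notin S -> #|nbr w :&: S| <= 2 * k) ->
    (forall u v, a u v = a v u) ->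
  exists z : T -> {ffun 'I_s -> bool},
    {in S &, forall u v, adj u v -> dot (z u) (z v) = a u v} /\
    forall w, w \notin S -> indep z (nbr w :&: S).
Proof.
move=> goodS a_sym; have [d] := ubnP #|S|; elim: d S goodS => // d IH S goodS leS.
have [->|Sn0] := eqVneq S set0.
  exists (fun=> zerov s); split=> [u|w _ J]; first by rewrite inE.
  by rewrite setI0 subset0 => ->.
have [v vS remv] := elim_order Sn0.
have nv : nbr v :&: (S :\ v) = nbr v :&: S.
  apply/setP => u; rewrite !inE; case: eqVneq => [->|//].
  by rewrite adj_irr.
have [||z [z_edge z_ind]] := IH (S :\ v).
- move=> w; rewrite !inE negb_and negbK => /orP[/eqP ->|wS].
    (* For [w = v] the degree bound comes from removability, because [X :&: S] contains [v]. *)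
    rewrite nv; case: remv => [->|[X vX]]; first by rewrite cards0.
    suff : 0 < #|X :&: S| by move: #|X :&: S| => [//|m] _; lia.
    by apply/card_gt0P; exists v; rewrite inE vX.
  apply: leq_trans (goodS w wS); apply: subset_leq_card.
  by rewrite setIS ?subD1set.
- by move: leS; rewrite (cardsD1 v S) vS.
have v' : v \notin S :\ v by rewrite !inE eqxx.
have sols := card_solutions (a v) (z_ind v v'); rewrite nv in sols.
have forb := card_forbidden z vS remv goodS.
have [y ySol yF] : exists2 y, y \in [set y | [forall u in nbr v :&: S,
    dot y (z u) == a v u]] &
    y \notin \bigcup_(w in nbr v :\: S) vspan z (nbr w :&: (S :\ v)).
  apply/subsetPn; apply: contraL forb => /subset_leq_card le.
  by rewrite -leqNgt; apply: leq_trans sols _; rewrite leq_mul2r le orbT.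
pose z' u : {ffun 'I_s -> bool} := if u == v then y else z u.
exists z'; rewrite /z'; split.
- have y_edge u : u \in S -> adj v u -> dot y (z u) = a v u.
    move=> uS vu; move: ySol; rewrite inE => /forall_inP /(_ u).
    by rewrite !inE vu uS => /(_ isT) /eqP.
  move=> u w uS wS uw.
  have [uv|uv] := eqVneq u v; have [wv|wv] := eqVneq w v.
  + by rewrite uv wv adj_irr in uw.
  + by rewrite uv in uw *; exact: y_edge.
  + by rewrite wv in uw *; rewrite dotC a_sym; apply: y_edge; rewrite // adj_sym.
  + by apply: z_edge => //; rewrite !inE ?uv ?wv.
- rewrite -/z' => w wS J JS J0.
  have z'z (I : {set T}) : v \notin I -> vsum z' I = vsum z I.
    move=> vI; apply: eq_vsum => u uI; rewrite /z'; case: eqVneq => // uv.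
    by rewrite -uv uI in vI.
  have wS' : w \notin S :\ v by rewrite !inE (negbTE wS) andbF.
  have [vJ|vJ] := boolP (v \in J); last first.
    rewrite z'z //; apply: (z_ind w wS') => //.
    apply/subsetP => u uJ; have := subsetP JS u uJ; rewrite !inE => /andP[-> ->].
    by rewrite !andbT; apply: contraNneq vJ => <-.
  (* A vanishing sum through [v] would put [y] into the span of the other placed neighbours of [w],
     where it is forbidden. *)
  rewrite -(setD1K vJ) vsumU1 ?z'z ?addv_eq0; try by rewrite !inE eqxx.
  rewrite {1}/z' eqxx; apply: contraNneq yF => ->.
  have := subsetP JS v vJ; rewrite !inE => /andP[wv _].
  apply/bigcupP; exists w; first by rewrite !inE wS adj_sym.
  apply/imsetP; exists (J :\ v) => //; rewrite powersetE.
  by rewrite setIDA setSD.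
Qed.

Lemma realize (a : rel T) : (forall u v, a u v = a v u) ->
  exists z : T -> {ffun 'I_s -> bool},
    forall u v, adj u v -> dot (z u) (z v) = a u v.
Proof.
move=> a_sym; have [|z [z_edge _]] := @realize_on a setT _ a_sym.
  by move=> w; rewrite inE.
by exists z => u v; apply: z_edge; rewrite inE.
Qed.
End Realize.

(** * Strong orientations in the presence of digons *)

Section Orientations.
Variable T : finType.
Implicit Types (E F : seq (T * T)) (p : T * T).

Lemma orients_mem E F p : orients E F -> p \in F ->
  (p \in E) || ((p.2, p.1) \in E).
Proof.
elim: E F => [|e E IH] [|f F] //= /andP[ef EF]; rewrite !inE.
case/orP => [/eqP ->|/(IH _ EF)/orP[]->]; rewrite ?orbT //.
by case/orP: ef => /eqP -> /=; rewrite -?surjective_pairing eqxx ?orbT.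
Qed.

(** Allows the list [F] to be read as a set of arcs, in which multiplicities are lost and an edge
    must not be directed both ways. *)
Lemma orients_uniq E F : orients E F -> uniq E ->
    {in E, forall p, (p.2, p.1) \notin E} ->
  uniq F /\ {in E, forall p, (p \in F) = ((p.2, p.1) \notin F)}.
Proof.
elim: E F => [|e E IH] [|f F] //= /andP[ef EF] /andP[eE uE] asym.
have asymE : {in E, forall p, (p.2, p.1) \notin E}.
  move=> p pE; have := asym p; rewrite inE pE orbT => /(_ isT).
  by rewrite inE negb_or => /andP[].
have e2E : (e.2, e.1) \notin E.
  by have := asym e (mem_head _ _); rewrite inE negb_or => /andP[].
have ee : (e.2, e.1) != e.
  by have := asym e (mem_head _ _); rewrite inE negb_or => /andP[].
have [uF memF] := IH F EF uE asymE.
have eF : e \notin F.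
  by apply/negP => /(orients_mem EF)/orP[]; apply/negP.
have e2F : (e.2, e.1) \notin F.
  apply/negP => /(orients_mem EF)/=; rewrite -surjective_pairing.
  by rewrite (negbTE eE) (negbTE e2E).
split.
  by rewrite uF andbT; case/orP: ef => /eqP ->.
move=> p; rewrite !inE => /orP[/eqP ->|pE].
  case/orP: ef => /eqP ->; rewrite ?eqxx (negbTE eF) (negbTE e2F) ?orbF /=.
    by rewrite ee.
  by rewrite eq_sym (negbTE ee).
rewrite (memF p pE); suff [-> ->] : (p == f) = false /\ ((p.2, p.1) == f) = false.
  by [].
have pe : p != e by apply: contraNneq eE => <-.
have pe2 : p != (e.2, e.1) by apply: contraNneq e2E => <-.
have swapK (q r : T * T) : ((q.2, q.1) == r) = (q == (r.2, r.1)).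
  by case: q r => [a b] [c d]; rewrite !xpair_eqE andbC.
by case/orP: ef => /eqP ->; rewrite ?swapK /= -?surjective_pairing
  (negbTE pe) (negbTE pe2).
Qed.

Lemma cut_enum (H : {set T * T}) (X : {set T}) :
  cut (enum H) X = #|[set p in H | crosses X p]|.
Proof.
rewrite /cut -size_filter cardE; apply/perm_size/uniq_perm => [||p].
- exact: filter_uniq (enum_uniq _).
- exact: enum_uniq.
- by rewrite mem_filter !mem_enum !inE andbC.
Qed.

(** The cuts of [G] are even, so those of [E ++ M] are even too. In a balanced orientation of
    [E ++ M], the imbalance of [E] at [X] is at most [cut M X], so twice the number of arcs leaving
    [X] is at least [cut E X - cut M X]. *)
Lemma digon_orientation (k : nat) E G : 0 < k ->
    edges_in setT (E ++ G) -> connected_on (2 * k) setT (E ++ G) ->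
    (forall X, ~~ odd (cut G X)) ->
  exists2 F, orients E F &
    forall X, separates X setT -> 2 * k <= 2 * count (leaves X) F + cut G X.
Proof.
move=> k0 EGA conEG evenG.
have [||M [_ oddM leM]] := parity_correction _ _ EGA conEG.
- by rewrite mul2n odd_double.
- by rewrite muln_gt0.
have [|FM /orients_cat[F [M' [eFM oF oM]]] bal] := @eulerian_orientation _ (E ++ M).
  move=> X; have := oddM X; rewrite !cut_cat !oddD (negbTE (evenG X)).
  by rewrite addbF.
exists F => // X sX; have := leM X sX; have := bal X.
rewrite eFM !count_cat cut_cat (orients_cut X oF) (orients_cut X oM).
by clear; lia.
Qed.

End Orientations.

(** * Tight sets *)

Section TightSets.
Variables (T : finType) (H : {set T * T}) (G : seq (T * T)) (k : nat).
Hypothesis conHG : connected_on (2 * k) setT (enum H ++ G).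

Notation E := (enum H ++ G).

Definition tight X := separates X setT && (cut E X == 2 * k).

Hypothesis tightH : {in H, forall e, exists2 X, tight X & crosses X e}.

Definition adj : rel T := fun u v => ((u, v) \in H) || ((v, u) \in H).

Lemma adj_sym : symmetric adj.
Proof. by move=> u v; rewrite /adj orbC. Qed.

Lemma separatesT (X : {set T}) : separates X setT = (X != set0) && (~: X != set0).
Proof. by rewrite /separates setIT setTD. Qed.

(** Both differences have cut at least [2 * k], so posimodularity forces equality. *)
Lemma tightD X Y : tight X -> tight Y -> X :\: Y != set0 -> Y :\: X != set0 ->
  tight (X :\: Y).
Proof.
rewrite /tight !separatesT => /andP[/andP[_ X1] /eqP cX] /andP[/andP[_ Y1] /eqP cY].
move=> XY YX.
have sXY : separates (X :\: Y) setT.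
  rewrite separatesT XY; apply: contraNneq X1 => h.
  by rewrite -subset0 -h setCS subsetDl.
have sYX : separates (Y :\: X) setT.
  rewrite separatesT YX; apply: contraNneq Y1 => h.
  by rewrite -subset0 -h setCS subsetDl.
rewrite -separatesT sXY; apply/eqP.
have := conHG sXY; have := conHG sYX; have := cut_posimod E X Y.
by rewrite cX cY; clear; lia.
Qed.

Lemma adj_crossing u v : adj u v ->
  exists2 X, tight X & (u \in X) (+) (v \in X).
Proof.
by case/orP => /tightH[X tX]; rewrite /crosses /= => ?; exists X; rewrite // addbC.
Qed.

(* A tight set meeting [S] in as few vertices as possible spans no edge of
   [H] inside [S], by uncrossing. *)
Lemma tight_independent (S : {set T}) u v : u \in S -> v \in S -> adj u v ->
  exists X, [/\ tight X, X :&: S != set0 &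
    {in X :&: S &, forall x y, ~~ adj x y}].
Proof.
move=> uS vS uv.
pose P X := tight X && (X :&: S != set0).
have meets (Y : {set T}) x y :
    x \in S -> y \in S -> (x \in Y) (+) (y \in Y) -> Y :&: S != set0.
  move=> xS yS; have [xY _|_ /= yY] := boolP (x \in Y).
    by apply/set0Pn; exists x; rewrite inE xY.
  by apply/set0Pn; exists y; rewrite inE yY.
have [X0 PX0] : exists X, P X.
  have [X tX uvX] := adj_crossing uv.
  by exists X; rewrite /P tX (meets _ u v).
case: (@arg_minnP _ X0 P (fun X => #|X :&: S|) PX0) => X /andP[tX X_S] minX.
exists X; split=> // x y; rewrite !inE => /andP[xX xS] /andP[yX yS].
apply/negP => /adj_crossing[Y tY xyY].
have [YX|nYX] := boolP (Y \subset X).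
  have /minX : P Y by rewrite /P tY (meets _ x y).
  rewrite leqNgt => /negP; apply; apply: proper_card; apply/properP.
  split; first exact: setSI.
  have [xY|xY] := boolP (x \in Y); last by exists x; rewrite !inE ?xX ?(negbTE xY).
  by exists y; rewrite !inE ?yX // andbC yS; move: xyY; rewrite xY; case: (y \in Y).
have nXY : (X :\: Y) :&: S != set0.
  apply: (meets _ x y) => //; rewrite !inE xX yX !andbT.
  by rewrite addNb addbN negbK.
have /minX : P (X :\: Y).
  rewrite /P nXY andbT; apply: tightD => //; last by rewrite setD_eq0.
  by apply: contraNneq nXY => ->; rewrite set0I.
rewrite leqNgt => /negP; apply; apply: proper_card; apply/properP.
split; first by rewrite setSI ?subsetDl.
have [xY|xY] := boolP (x \in Y); first by exists x; rewrite !inE ?xX ?xY.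
by exists y; rewrite !inE ?yX //; move: xyY; rewrite (negbTE xY) /= => ->.
Qed.

(** Each pair is sent to its representative in [H]; this is injective because the direction out of
    [X] recovers the pair. *)
Lemma card_crossing (X : {set T}) :
  #|[set p : T * T | [&& adj p.1 p.2, p.1 \in X & p.2 \notin X]]| <= cut (enum H) X.
Proof.
rewrite cut_enum.
pose g (p : T * T) := if p \in H then p else (p.2, p.1).
rewrite -(card_in_imset (f := g)).
  apply/subset_leq_card/subsetP => _ /imsetP[p + ->].
  rewrite !inE /g /adj -surjective_pairing => /and3P[pH p1 p2].
  case: ifP pH => [-> _|_ /= ->]; rewrite /crosses /= ?p1 (negbTE p2) //.
move=> [a b] [c d]; rewrite !inE /= /g => /and3P[_ a1 b1] /and3P[_ c1 d1].
case: ifP; case: ifP => _ _ //= [] // e1 e2.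
- by rewrite ?e1 ?e2 ?c1 ?a1 -?e1 ?a1 in b1 d1.
- by rewrite ?e1 ?e2 ?c1 ?a1 -?e1 ?a1 in b1 d1.
- by rewrite e1 e2.
Qed.

Lemma exists_removable (S : {set T}) : S != set0 ->
  exists2 v, v \in S & removable adj k S v.
Proof.
case/set0Pn => v0 v0S.
case: (pickP (fun p : T * T => [&& p.1 \in S, p.2 \in S & adj p.1 p.2])).
  move=> [u u'] /= /and3P[uS u'S uu'].
  have [X [tX X_S indX]] := tight_independent uS u'S uu'.
  have /set0Pn[x0 x0X] := X_S.
  case: (@arg_minnP _ x0 (mem (X :&: S)) (fun v => #|nbr adj v :&: S|) x0X).
  move=> v vXS minv; have /setIP[vX vS] : v \in X :&: S by [].
  exists v => //; right; exists X => //.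
  pose C := [set p : T * T | [&& adj p.1 p.2, p.1 \in X & p.2 \notin X]].
  pose Q := [set p in C | (p.1 \in S) && (p.2 \in S)].
  have leC : #|C| <= 2 * k.
    case/andP: tX => _ /eqP <-; rewrite cut_cat.
    exact: leq_trans (card_crossing X) (leq_addr _ _).
  apply: leq_trans leC; rewrite -(cardsID Q C) addnC; apply: leq_add.
    (* Every edge from [X :&: S] into [S] leaves [X], and each vertex of [X :&: S] has at least as
       many of them as [v]; this bounds [Q] from below by the product. *)
    apply: (@leq_trans (\sum_(x in X :&: S) \sum_(y in nbr adj x :&: S) 1)).
      by rewrite -sum_nat_const; apply: leq_sum => x /minv; rewrite sum1_card.
    rewrite pair_big_dep /= sum1_card; apply/subset_leq_card/subsetP => -[x y].
    rewrite unfold_in /= !inE /= => /andP[/andP[xX xS] /andP[xy yS]].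
    have yX : y \notin X.
      by apply: contraTN xy => yX; apply: indX; rewrite inE ?xX ?yX.
    by rewrite xy xX yX xS yS.
  (* An exceptional [w] outside [X] is charged to the edge [vw], one inside [X] to an edge from [w]
     into [S] leaving [X]. As [w] is not in [S], neither edge lies in [Q]. The [pick] succeeds for
     exceptional [w], so the default [v] is never taken. *)
  pose g w := if w \in X then (w, odflt v [pick y in (nbr adj w :&: S) :\: X])
              else (v, w).
  rewrite -(card_in_imset (f := g)).
    apply/subset_leq_card/subsetP => _ /imsetP[w + ->]; rewrite !inE /g.
    case/andP => /andP[wS vw]; have [wX /=|wX _] := boolP (w \in X); last first.
      by rewrite /= vw vX wX (negbTE wS) vS.
    move=> /subsetPn[y]; rewrite !inE => /andP[wy yS] yX.
    case: pickP => [y'|/(_ y)]; last by rewrite !inE wy yS yX.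
    rewrite !inE /= => /and3P[y'X wy' y'S].
    by rewrite wy' wX y'X (negbTE wS).
  move=> w1 w2; rewrite !inE /g => /andP[/andP[w1S _] _] /andP[/andP[w2S _] _].
  case: ifP; case: ifP => _ _ [] //.
  - by move=> e; rewrite e vS in w1S.
  - by move=> e; rewrite -e vS in w2S.
move=> none; exists v0 => //; left; apply/setP => w; rewrite !inE.
by apply/negbTE/negP => /andP[vw wS]; have := none (v0, w); rewrite /= v0S wS vw.
Qed.

End TightSets.

(** * Inversions from vectors *)

Lemma odd_count (I : Type) (a : pred I) (r : seq I) :
  odd (count a r) = \big[addb/false]_(i <- r) a i.
Proof. by elim: r => [|i r IH]; rewrite ?big_nil // big_cons /= oddD oddb IH. Qed.

Section Inversion.
Variables (n k : nat) (D : rel 'I_n).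
Hypotheses (k_gt0 : 0 < k) (D_irr : loopless D) (conD : edge_connected (2 * k) D).

(** The coordinates of [z v] record which of the inverted sets contain [v], so a dot product is the
    parity of the number of sets containing both vertices. *)
Lemma inv_familyE s (z : 'I_n -> {ffun 'I_s -> bool}) u v :
  inv_family D [seq [set v | z v i] | i <- enum 'I_s] u v =
    if dot (z u) (z v) then D v u else D u v.
Proof.
rewrite /inv_family count_map odd_count big_enum /dot.
by congr (if _ then _ else _); apply: eq_bigr => i _; rewrite /= !inE.
Qed.

(** Each digon yields both ordered pairs, that is, its two parallel edges. *)
Definition digons := enum [set p : 'I_n * 'I_n | D p.1 p.2 && D p.2 p.1].
Definition single_arcs := [set p : 'I_n * 'I_n | D p.1 p.2 && ~~ D p.2 p.1].

Lemma mem_digons p : (p \in digons) = D p.1 p.2 && D p.2 p.1.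
Proof. by rewrite mem_enum inE. Qed.

Lemma cut_digons X : cut digons X = 2 * count (leaves X) digons.
Proof.
have -> : cut digons X = count (leaves X) digons + count (leaves (~: X)) digons.
  apply: orients_cut; rewrite /orients; elim: digons => //= e E ->.
  by rewrite /same_edge eqxx.
rewrite mul2n -addnn; congr (_ + _); rewrite -!size_filter.
pose swap (p : 'I_n * 'I_n) := (p.2, p.1).
have swapK : involutive swap by case.
rewrite -(size_map swap); apply/perm_size/uniq_perm => [||p].
- by rewrite (map_inj_uniq (can_inj swapK)) filter_uniq ?enum_uniq.
- exact: filter_uniq (enum_uniq _).
- rewrite -{1}(swapK p) (mem_map (can_inj swapK)) mem_filter mem_digons
    [in RHS]mem_filter mem_digons /=.
  rewrite /leaves /= !inE negbK.
  by case: (D p.1 p.2); case: (D p.2 p.1); case: (p.1 \in X); case: (p.2 \in X).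
Qed.

Lemma connected_arcs : connected_on (2 * k) setT (enum single_arcs ++ digons).
Proof.
move=> X; rewrite separatesT => /andP[X0 X1]; apply: leq_trans (conD X0 X1) _.
rewrite cut_cat /digons !cut_enum /narcs.
set A1 := finset _; set A2 := finset _.
have dA : [disjoint A1 & A2].
  by apply/pred0P => p; rewrite /= !inE; case: (p.1 \in X); rewrite !andbF.
apply: leq_trans (leq_card_setU _ _); rewrite -cardsUI.
have -> : A1 :&: A2 = set0 by apply/eqP; rewrite setI_eq0.
rewrite cards0 addn0; apply/subset_leq_card/subsetP => p; rewrite !inE /crosses.
by case: (D p.1 p.2); case: (D p.2 p.1); case: (p.1 \in X); case: (p.2 \in X).
Qed.

(** The choice of vectors enters as a hypothesis so that order three can be treated apart. *)
Lemma exists_inversion (s : nat) :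
    (forall e : rel 'I_n, symmetric e -> irreflexive e ->
      (forall S : {set 'I_n}, S != set0 ->
        exists2 v, v \in S & removable e k S v) ->
      forall a : rel 'I_n, (forall u v, a u v = a v u) ->
      exists z : 'I_n -> {ffun 'I_s -> bool},
        forall u v, e u v -> dot (z u) (z v) = a u v) ->
  exists Xs : seq {set 'I_n}, size Xs = s /\ arc_strong k (inv_family D Xs).
Proof.
move=> realizable.
(* In a smallest such [H] every arc crosses a tight set. Single arcs outside [H] may end up in
   either direction. *)
pose P (H : {set 'I_n * 'I_n}) := (H \subset single_arcs) &&
  [forall X, separates X setT ==> (2 * k <= cut (enum H ++ digons) X)].
have PB : P single_arcs.
  rewrite /P subxx; apply/forallP => X; apply/implyP; exact: connected_arcs.
case: (@arg_minnP _ single_arcs P (fun H => #|H|) PB) => H /andP[HB conH] minH.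
have {}conH : connected_on (2 * k) setT (enum H ++ digons).
  by move=> X; apply/implyP/(forallP conH).
have H_arc p : p \in H -> D p.1 p.2 && ~~ D p.2 p.1.
  by move/(subsetP HB); rewrite inE.
have cutH e X : e \in H -> cut (enum H ++ digons) X =
    crosses X e + cut (enum (H :\ e) ++ digons) X.
  move=> eH; rewrite !cut_cat !cut_enum addnA; congr (_ + _).
  rewrite (cardsD1 e [set p in H | _]) inE eH; congr (_ + _).
  by apply: eq_card => p; rewrite !inE andbA.
have tightH : {in H, forall e, exists2 X, tight H digons k X & crosses X e}.
  move=> e eH; have : ~~ P (H :\ e).
    by apply/negP => /minH; rewrite (cardsD1 e H) eH ltnn.
  rewrite /P (subset_trans (subsetDl _ _) HB) negb_forall => /existsP[X].
  rewrite negb_imply -ltnNge => /andP[sX ltX]; exists X.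
    rewrite /tight sX eqn_leq conH // andbT (cutH e) //; move: ltX.
    by case: crosses => /= lt; [exact: lt | exact: ltnW].
  have := conH X sX; rewrite (cutH e) //; case: crosses => //=.
  by rewrite add0n leqNgt ltX.
have H_asym u v : (u, v) \in H -> (v, u) \notin H.
  by move/H_arc => /= /andP[_ uv]; apply: contra uv => /H_arc /andP[].
have H_irr v : (v, v) \notin H by apply/negP => /H_arc /=; rewrite D_irr.
have e_irr : irreflexive (adj H) by move=> v; rewrite /adj orbb; apply/negbTE.
have EA : edges_in setT (enum H ++ digons).
  rewrite /edges_in all_cat; apply/andP; split; apply/allP => -[u v];
    rewrite ?mem_digons ?mem_enum !inE /= => uv; apply: contraTneq uv => ->.
    exact: H_irr.
  by rewrite D_irr.
have [|F oF strongF] := digon_orientation k_gt0 EA conH.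
  by move=> X; rewrite cut_digons mul2n odd_double.
have [uF memF] : uniq F /\ {in enum H, forall p, (p \in F) = ((p.2, p.1) \notin F)}.
  apply: orients_uniq oF (enum_uniq _) _ => -[u v]; rewrite !mem_enum.
  exact: H_asym.
have adjF u v : adj H u v -> ((v, u) \in F) = ~~ ((u, v) \in F).
  case/orP => uvH; have := memF (_, _); last first.
    by move=> h; rewrite h ?mem_enum.
  by move=> h; rewrite (h u v) ?mem_enum ?negbK.
have adjD u v : adj H u v -> D v u = ~~ D u v.
  by case/orP => /H_arc /= /andP[]; case: (D u v); case: (D v u).
(* The arc between [u] and [v] must be reversed exactly when [D] and [F] disagree on it; restricting
   to [adj H] makes [a] symmetric. *)
pose a u v := adj H u v && (((u, v) \in F) (+) D u v).
have [|z hz] := realizable (adj H) (adj_sym H) e_irr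
  (exists_removable conH tightH) a.
  move=> u v; rewrite /a adj_sym; case uv: (adj H v u) => //=.
  by rewrite (adjF v u) // (adjD v u) // addNb addbN negbK.
exists [seq [set v | z v i] | i <- enum 'I_s].
split; first by rewrite size_map -cardE card_ord.
move=> X X0 X1; set D' := inv_family _ _.
have D'F p : p \in F -> D' p.1 p.2.
  move=> pF; have p_adj : adj H p.1 p.2.
    by have := orients_mem oF pF; rewrite !mem_enum /adj -surjective_pairing.
  rewrite /D' inv_familyE hz // /a p_adj -surjective_pairing pF /=.
  by case Dp: (D p.1 p.2); rewrite // adjD // Dp.
have D'G p : p \in digons -> D' p.1 p.2.
  rewrite mem_digons => /andP[p1 p2]; rewrite /D' inv_familyE.
  by case: dot.
have disj p : p \in F -> p \notin digons.
  move=> pF; rewrite mem_digons; have := orients_mem oF pF; rewrite !mem_enum.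
  by case/orP => /H_arc /= /andP[-> /negbTE ->]; rewrite ?andbF.
have uFG : uniq (F ++ digons).
  rewrite cat_uniq uF enum_uniq andbT /=; apply/hasPn => p; exact: contraL (disj p).
have := strongF X; rewrite separatesT X0 X1 cut_digons -mulnDr leq_mul2l /=.
move=> /(_ isT) /leq_trans; apply.
rewrite -count_cat -size_filter /narcs cardE; apply: uniq_leq_size.
  exact: filter_uniq.
move=> p; rewrite mem_filter mem_cat => /andP[/andP[p1 p2] pFG].
rewrite mem_enum !inE p1 p2 !andbT.
by case/orP: pFG => [/D'F|/D'G].
Qed.
End Inversion.

(** * Order three and the upper bound *)

Definition vec2 (p q : bool) : {ffun 'I_2 -> bool} :=
  [ffun i => if i == ord0 then p else q].

Lemma dot_vec2 p q p' q' : dot (vec2 p q) (vec2 p' q') = (p && p') (+) (q && q').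
Proof. by rewrite /dot !big_ord_recl big_ord0 !ffunE /= addbF. Qed.

(** The greedy count needs [1 < N], which fails at order three. There [k = 1], two coordinates are
    available, and the eight prescriptions are solved by hand. *)
Lemma realize3 (a : rel 'I_3) : (forall u v, a u v = a v u) ->
  exists z : 'I_3 -> {ffun 'I_2 -> bool},
    forall u v, u != v -> dot (z u) (z v) = a u v.
Proof.
move=> a_sym; pose o i : 'I_3 := inord i.
have [x0 [x1 [x2 [h01 h02 h12]]]] : exists x0 x1 x2 : {ffun 'I_2 -> bool},
    [/\ dot x0 x1 = a (o 0) (o 1), dot x0 x2 = a (o 0) (o 2) &
        dot x1 x2 = a (o 1) (o 2)].
  case: (a (o 0) (o 1)); case: (a (o 0) (o 2)); case: (a (o 1) (o 2)).
  - by exists (vec2 true false), (vec2 true false), (vec2 true false);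
      rewrite !dot_vec2.
  - by exists (vec2 true true), (vec2 true false), (vec2 false true);
      rewrite !dot_vec2.
  - by exists (vec2 true false), (vec2 true true), (vec2 false true);
      rewrite !dot_vec2.
  - by exists (vec2 true false), (vec2 true false), (vec2 false true);
      rewrite !dot_vec2.
  - by exists (vec2 false true), (vec2 true false), (vec2 true true);
      rewrite !dot_vec2.
  - by exists (vec2 false true), (vec2 true false), (vec2 false true);
      rewrite !dot_vec2.
  - by exists (vec2 false false), (vec2 true false), (vec2 true true);
      rewrite !dot_vec2.
  - by exists (vec2 false false), (vec2 true false), (vec2 false true);
      rewrite !dot_vec2.
exists (fun u => nth x0 [:: x0; x1; x2] u) => u v.
have oE (w : 'I_3) : o w = w by apply: val_inj; rewrite /= inordK.
rewrite -(oE u) -(oE v).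
case: u v => [[|[|[|//]]] ?] [[|[|[|//]]] ?]; rewrite ?eqxx //= => _;
  by rewrite !inordK //= ?h01 ?h02 ?h12 // dotC ?h01 ?h02 ?h12 a_sym.
Qed.

Lemma upper_bound n k (D : rel 'I_n) : 0 < k -> k + 2 <= n -> loopless D ->
    edge_connected (2 * k) D ->
  exists Xs : seq {set 'I_n}, size Xs = trunc_log 2 n + 4 * k - 3 /\
    arc_strong k (inv_family D Xs).
Proof.
move=> k_gt0 kn D_irr conD.
apply: exists_inversion => // e e_sym e_irr e_rem a a_sym.
have [n_gt3|n_le3] := ltnP 3 n.
  apply: (realize e_sym e_irr k_gt0 _ _ e_rem a_sym).
    by apply: trunc_log_max.
  by rewrite card_ord trunc_log_ltn.
have [n3 k1] : n = 3 /\ k = 1 by lia.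
move: D D_irr conD e e_sym e_irr e_rem a a_sym.
rewrite {}n3 {}k1 => D _ _ e _ e_irr _ a /realize3[z hz]; exists z => u v uv.
by apply: hz; apply: contraTneq uv => ->; rewrite e_irr.
Qed.

(** * The lower bound *)

(* The pair of vertices below [m] to which the vertex [w] is attached. Every
   pair [i < j < m] is attached to [m * j + i]; the other [w] use [(0, 1)]. *)
Definition attached (m w : nat) : nat * nat :=
  if (w %/ m < m) && (w %% m != w %/ m) then (w %% m, w %/ m) else (0, 1).

Lemma attachedP m w : 1 < m ->
  [/\ (attached m w).1 < m, (attached m w).2 < m &
      (attached m w).1 != (attached m w).2].
Proof.
move=> m1; rewrite /attached; case: ifP => [/andP[] |_] //=; last first.
  by split => //; apply: ltnW.
by rewrite ltn_mod => -> ->; split=> //; apply: ltnW.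
Qed.

Lemma attached_pair m i j : i < j -> j < m -> attached m (j * m + i) = (i, j).
Proof.
move=> ij jm; have im := ltn_trans ij jm; have m0 := leq_ltn_trans (leq0n _) jm.
rewrite /attached modnMDl divnMDl // modn_small // divn_small // addn0 jm.
by rewrite neq_ltn ij.
Qed.

Lemma exists_third a b : exists t, [/\ t < 3, t != a & t != b].
Proof.
case: a => [|[|a]]; case: b => [|[|b]]; by [exists 0|exists 1|exists 2].
Qed.

Section LowerBound.
Variables (n k : nat).
Hypotheses (k_gt0 : 0 < k) (kn : k + 2 <= n).

(* Vertices [q <= u] form a core joined to everything by digons. *)
Let q := n - k + 1.

Variable m : nat.
Hypotheses (m_sqr : m * m <= q) (q_sqr : q < m.+1 * m.+1).
Hypothesis m_big : q = 3 \/ 1 < m.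

(** As [m] is the integer square root of [q], the codes [m * j + i] of pairs below [m] stay under
    [q]. For [q = 3] no pair exists, and a transitive triangle is used instead. *)
Definition base_arc (u v : nat) : bool :=
  if q == 3 then u < v
  else [&& u < m, m <= v & (u == (attached m v).1) || (u == (attached m v).2)].

Definition hard_digraph : rel 'I_n := fun u v =>
  if (q <= u) || (q <= v) then u != v else base_arc u v.

Lemma q_leq : q <= n. Proof. rewrite /q; lia. Qed.
Lemma q_gt2 : 2 < q. Proof. rewrite /q; lia. Qed.

Definition vtx (x : nat) (lt : x < q) : 'I_n := Ordinal (leq_trans lt q_leq).

Definition core := [set u : 'I_n | q <= u].

Lemma card_core : #|core| = k - 1.
Proof.
have -> : core = ~: [set u : 'I_n | u < q].
  by apply/setP => u; rewrite !inE -leqNgt.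
rewrite cardsCs setCK card_ord.
have -> : [set u : 'I_n | u < q] = [set widen_ord q_leq i | i : 'I_q].
  apply/setP => u; rewrite inE.
  apply/idP/imsetP => [uq|[i _ ->]]; last by rewrite /= ltn_ord.
  by exists (Ordinal uq) => //; apply: val_inj.
rewrite card_imset ?card_ord; last by move=> i j /(congr1 val) /= /val_inj.
rewrite /q; lia.
Qed.

Lemma hard_baseE (u v : 'I_n) : u < q -> v < q -> hard_digraph u v = base_arc u v.
Proof. by move=> uq vq; rewrite /hard_digraph leqNgt uq leqNgt vq. Qed.

Lemma hard_loopless : loopless hard_digraph.
Proof.
move=> v; rewrite /hard_digraph eqxx; case: ifP => // /negbT.
rewrite negb_or -ltnNge andbb => vq; rewrite /base_arc ltnn; case: ifP => // _.
by case: ltnP.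
Qed.

(** Each core vertex supplies one arc from [X] to [Y], either to [b] or from [a] according to its
    side; these arcs have an end in the core and so differ from the base arcs. *)
Lemma narcs_core (X Y : {set 'I_n}) (a b : 'I_n) : Y = ~: X ->
    a \in X -> b \in Y -> a < q -> b < q ->
  k - 1 + #|[set p : 'I_n * 'I_n | [&& hard_digraph p.1 p.2, p.1 < q, p.2 < q,
                p.1 \in X & p.2 \in Y]]| <= narcs hard_digraph X Y.
Proof.
move=> -> aX bX aq bq; rewrite inE in bX.
pose g c := if c \in X then (c, b) else (a, c).
have g_inj : {in core &, injective g}.
  move=> c d; rewrite !inE /g => qc qd; case: ifP; case: ifP => _ _ [] //.
  - by move=> e _; rewrite e leqNgt aq in qc.
  - by move=> e _; rewrite -e leqNgt aq in qd.
rewrite -card_core -(card_in_imset g_inj) /narcs -cardsUI addnC.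
rewrite [X in X + _](_ : _ = 0) ?add0n.
  apply/subset_leq_card/subsetP => p; rewrite !inE.
  case/orP => [/imsetP[c + ->]|/and5P[-> _ _ -> ->]//].
  rewrite inE /g => qc; have [cX|cX] /= := boolP (c \in X).
    rewrite cX bX /hard_digraph qc /= !andbT; apply: contraTneq qc => ->.
    by rewrite -ltnNge.
  rewrite aX cX /hard_digraph qc orbT /= !andbT eq_sym.
  by apply: contraTneq qc => ->; rewrite -ltnNge.
apply/eqP; rewrite cards_eq0 -subset0; apply/subsetP => p; rewrite !inE.
case/andP => /imsetP[c + ->]; rewrite inE /g => qc.
by case: ifP => _ /=; rewrite ?(ltnNge c) qc ?andbF.
Qed.

(** All pairs between the two sides are arcs, and two positive numbers with sum [n] have product at
    least [n - 1]. *)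
Lemma narcs_in_core (X Y : {set 'I_n}) : X != set0 -> Y = ~: X ->
  Y != set0 -> (X \subset core) || (Y \subset core) -> k <= narcs hard_digraph X Y.
Proof.
move=> X0 eY Y0 XY; apply: (@leq_trans (#|X| * #|Y|)).
  have := cardsC X; rewrite card_ord -eY.
  by move: X0 Y0; rewrite -!card_gt0 => ? ? ?; nia.
rewrite -cardsX /narcs; apply/subset_leq_card/subsetP => -[u v].
rewrite !inE /= => /andP[uX vY]; rewrite uX vY andbT andbT /hard_digraph.
have -> : (q <= u) || (q <= v).
  by case/orP: XY => /subsetP h; [have := h u uX | have := h v vY];
    rewrite inE => ->; rewrite ?orbT.
by apply: contraTneq vY => <-; rewrite eY inE uX.
Qed.

(** Whichever side contains [w], one of [x] and [y] is on the other. Recording the head [w] keeps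
    arcs for different [w] apart. *)
Lemma attached_crossing (X : {set 'I_n}) (w x y : 'I_n) : q != 3 ->
    m <= w < q -> x < m -> y < m -> x \in X -> y \notin X ->
    attached m w = (val x, val y) \/ attached m w = (val y, val x) ->
  exists p : 'I_n * 'I_n, [/\ p.2 = w, hard_digraph p.1 p.2, p.1 < q, p.2 < q &
    crosses X p].
Proof.
move=> q3 /andP[mw wq] xm ym xX yX att.
have m_le : m <= q by nia.
have [wX|wX] := boolP (w \in X); [exists (y, w) | exists (x, w)];
  split=> //=; rewrite ?(leq_trans _ m_le) //.
- rewrite /hard_digraph leqNgt (leq_trans ym m_le) leqNgt wq /base_arc.
  by rewrite (negbTE q3) ym mw; case: att => -> /=; rewrite eqxx ?orbT.
- by rewrite /crosses /= wX (negbTE yX).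
- rewrite /hard_digraph leqNgt (leq_trans xm m_le) leqNgt wq /base_arc.
  by rewrite (negbTE q3) xm mw; case: att => -> /=; rewrite eqxx ?orbT.
- by rewrite /crosses /= xX (negbTE wX).
Qed.

Lemma exists_attached (x y : 'I_n) : q != 3 -> x < m -> y < m -> x != y ->
  exists w : 'I_n, m <= w < q /\
   (attached m w = (val x, val y) \/ attached m w = (val y, val x)).
Proof.
move=> q3 xm ym xy; suff main i j : i < j -> j < m ->
    exists w : 'I_n, m <= w < q /\ attached m w = (i, j).
  case: (ltngtP x y) => [lt|lt|/val_inj e]; last by rewrite e eqxx in xy.
  - by have [w [h1 h2]] := main x y lt ym; exists w; split => //; left.
  - by have [w [h1 h2]] := main y x lt xm; exists w; split => //; right.
move=> ij jm; have lt : j * m + i < q by nia.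
exists (vtx lt); rewrite /= lt andbT; split; last exact: attached_pair.
by nia.
Qed.

(** Outside the triangle case: if [X] splits the vertices below [m], two vertices attached to split
    pairs each give a crossing arc; otherwise some [w] above them lies opposite to all of them, and
    both its arcs cross. *)
Lemma base_two_crossings (X : {set 'I_n}) (a b : 'I_n) : a < q -> b < q ->
    a \in X -> b \notin X ->
  1 < #|[set p : 'I_n * 'I_n | [&& hard_digraph p.1 p.2, p.1 < q, p.2 < q &
         crosses X p]]|.
Proof.
move=> aq bq aX bX; apply/card_gt1P.
suff [p1 [p2 [h1 h2 h3]]] : exists p1 p2 : 'I_n * 'I_n,
  [/\ [&& hard_digraph p1.1 p1.2, p1.1 < q, p1.2 < q & crosses X p1],
      [&& hard_digraph p2.1 p2.2, p2.1 < q, p2.2 < q & crosses X p2] & p1 != p2].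
  by exists p1, p2; rewrite !inE.
have [q3|q3] := eqVneq q 3.
  pose e (x y : 'I_n) := if x < y then (x, y) else (y, x).
  have eP (x y : 'I_n) : x < q -> y < q -> x \in X -> y \notin X ->
      [&& hard_digraph (e x y).1 (e x y).2, (e x y).1 < q, (e x y).2 < q &
          crosses X (e x y)].
    move=> xq yq xX yX; rewrite /e /crosses.
    have bE u v : base_arc u v = (u < v) by rewrite /base_arc q3 eqxx.
    case: (ltngtP x y) => /= [lt|lt|/val_inj xy]; last by rewrite -xy xX in yX.
    - by rewrite hard_baseE // bE lt xq yq xX (negbTE yX).
    - by rewrite hard_baseE // bE lt xq yq xX (negbTE yX).
  have [t [tq ta tb]] : exists t : 'I_n, [/\ t < q, t != a & t != b].
    have [t [t3 ta tb]] := exists_third a b.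
    by rewrite -q3 in t3; exists (vtx t3).
  have ab : a != b by apply: contraNneq bX => <-.
  have e_inj (x y x' y' : 'I_n) : x' != x -> x' != y -> e x y != e x' y'.
    move=> h1 h2; rewrite /e; case: ifP => _; case: ifP => _;
    by rewrite xpair_eqE negb_and ?[x == _]eq_sym ?[y == _]eq_sym ?h1 ?h2 ?orbT.
  have [tX|tX] := boolP (t \in X).
    exists (e a b), (e t b); split; [exact: eP|exact: eP|].
    exact: e_inj.
  exists (e a b), (e a t); split; [exact: eP|exact: eP|].
  rewrite eq_sym /e; case: ifP => _; case: ifP => _; rewrite xpair_eqE negb_and;
  by rewrite ?ta ?tb ?[a == _]eq_sym ?[b == _]eq_sym ?ta ?tb ?orbT.
have m_gt1 : 1 < m by case: m_big => // e; rewrite e eqxx in q3.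
have m_le : m <= q by nia.
have two_w (w1 w2 : 'I_n) : w1 != w2 ->
    (exists p : 'I_n * 'I_n, [/\ p.2 = w1, hard_digraph p.1 p.2, p.1 < q, p.2 < q &
    crosses X p]) ->
    (exists p : 'I_n * 'I_n, [/\ p.2 = w2, hard_digraph p.1 p.2, p.1 < q, p.2 < q &
    crosses X p]) ->
  exists p1 p2 : 'I_n * 'I_n,
  [/\ [&& hard_digraph p1.1 p1.2, p1.1 < q, p1.2 < q & crosses X p1],
      [&& hard_digraph p2.1 p2.2, p2.1 < q, p2.2 < q & crosses X p2] & p1 != p2].
  move=> w12 [p1 [e1 a1 b1 c1 d1]] [p2 [e2 a2 b2 c2 d2]]; exists p1, p2.
  split; [by rewrite a1 b1 c1|by rewrite a2 b2 c2|].
  by apply: contraNneq w12 => e; rewrite -e1 -e2 e.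
case: (pickP (fun p : 'I_n * 'I_n =>
  [&& p.1 < m, p.2 < m, p.1 \in X & p.2 \notin X])).
  move=> [i j] /= /and4P[im jm iX jX].
  have ij : i != j by apply: contraNneq jX => <-.
  have [w [wq att]] := exists_attached q3 im jm ij.
  (* A third vertex [t] below [m] forms a second split pair with [i] or [j]. *)
  have [m3|m_le2] := ltnP 2 m.
    have [t0 [t3 ti tj]] := exists_third i j.
    have tm := leq_trans t3 m3; pose t := vtx (leq_trans tm m_le).
    have {}ti : t != i by []; have {}tj : t != j by [].
    have [tX|tX] := boolP (t \in X).
      have [w2 [w2q att2]] := exists_attached q3 (tm : t < m) jm tj.
      apply: (two_w w w2).
      - apply: contraNneq ti => e; rewrite -val_eqE; move: att2; rewrite -e.
        by case: att => -> [] [] * /=; apply/eqP; congruence.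
      - exact: attached_crossing wq im jm iX jX att.
      - exact: attached_crossing w2q _ jm tX jX att2.
    rewrite eq_sym in ti.
    have [w2 [w2q att2]] := exists_attached q3 im (tm : t < m) ti.
    apply: (two_w w w2).
    - apply: contraNneq tj => e; rewrite -val_eqE; move: att2; rewrite -e.
      by case: att => -> [] [] * /=; apply/eqP; congruence.
    - exact: attached_crossing wq im jm iX jX att.
    - exact: attached_crossing w2q im _ iX tX att2.
  (* Now [q >= 4], and the vertices 2 and 3 are both attached to [(0, 1)], the latter by default. *)
  have m2 : m = 2 by lia.
  have att01 w' : w' = 2 \/ w' = 3 ->
      attached m w' = (val i, val j) \/ attached m w' = (val j, val i).
    move=> w'E; have -> : attached m w' = (0, 1) by rewrite m2; case: w'E => ->.
    have [[-> ->]|[-> ->]] : (val i = 0 /\ val j = 1) \/ (val i = 1 /\ val j = 0).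
    + by move: im jm ij; rewrite m2 -val_eqE /=; clear; lia.
    + by left.
    + by right.
  have q2 : 2 < q by nia.
  have q3' : 3 < q by nia.
  apply: (two_w (vtx q2) (vtx q3')) => //.
  - apply: (attached_crossing q3 _ im jm iX jX); last by apply: att01; left.
    by rewrite /= q2 m2.
  - apply: (attached_crossing q3 _ im jm iX jX); last by apply: att01; right.
    by rewrite /= q3' m2.
move=> none.
have q0 : 0 < q by nia.
have side (i : 'I_n) : i < m -> (i \in X) = (vtx q0 \in X).
  move=> im; have := none (i, vtx q0); have := none (vtx q0, i).
  by rewrite /= im (ltnW m_gt1); case: (i \in X); case: (vtx q0 \in X).
have [w [wq mw wX]] : exists w : 'I_n, [/\ w < q, m <= w &
    (w \in X) = ~~ (vtx q0 \in X)].
  have [zX|zX] := boolP (vtx q0 \in X); [exists b|exists a].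
    split; [by []| |exact/negbTE].
    by rewrite leqNgt; apply: contra bX => /side ->.
  by split=> //; rewrite leqNgt; apply: contraL aX => /side ->.
have [x1 x2 x12] := attachedP w m_gt1.
have arc_w (x : nat) (xm : x < m) :
    (x == (attached m w).1) || (x == (attached m w).2) ->
    [&& hard_digraph (vtx (leq_trans xm m_le)) w, vtx (leq_trans xm m_le) < q, w < q
      & crosses X (vtx (leq_trans xm m_le), w)].
  move=> hx; rewrite /crosses /= side // wX addbN addbb andbT wq andbT.
  rewrite (leq_trans xm m_le) andbT hard_baseE //=; last exact: leq_trans m_le.
  by rewrite /base_arc (negbTE q3) xm mw hx.
exists (vtx (leq_trans x1 m_le), w), (vtx (leq_trans x2 m_le), w).
split; [by apply: arc_w; rewrite eqxx|by apply: arc_w; rewrite eqxx orbT|].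
by rewrite xpair_eqE -val_eqE /= (negbTE x12).
Qed.

(** The core gives [k - 1] arcs in each direction, and the base adds two edges. *)
Lemma hard_edge_connected : edge_connected (2 * k) hard_digraph.
Proof.
move=> X X0 X1.
have [XN|] := boolP (X \subset core).
  have := narcs_in_core X0 erefl X1; rewrite XN => /(_ isT).
  have := narcs_in_core X1 (esym (setCK X)) X0; rewrite XN orbT => /(_ isT).
  lia.
move=> /subsetPn[a aX]; rewrite inE -ltnNge => aq.
have [XN|] := boolP (~: X \subset core).
  have := narcs_in_core X0 erefl X1; rewrite XN orbT => /(_ isT).
  have := narcs_in_core X1 (esym (setCK X)) X0; rewrite XN => /(_ isT).
  lia.
move=> /subsetPn[b bX]; rewrite inE -ltnNge => bq.
have h1 := narcs_core erefl aX bX aq bq.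
have h2 := narcs_core (esym (setCK X)) bX aX bq aq.
rewrite inE in bX.
have h3 := base_two_crossings aq bq aX bX.
set A1 := finset _ in h1; set A2 := finset _ in h2; set A3 := finset _ in h3.
suff : #|A3| <= #|A1| + #|A2| by move: h1 h2 h3 k_gt0; clear; lia.
apply: leq_trans (leq_card_setU _ _); apply/subset_leq_card/subsetP => p.
rewrite !inE => /and4P[-> -> ->]; rewrite /crosses /=.
by case: (p.1 \in X); case: (p.2 \in X).
Qed.

Lemma exists_neq (v : 'I_n) : exists y, y != v.
Proof.
have q1 : 1 < q := ltnW q_gt2.
have [->|e] := eqVneq v (vtx q1); last by exists (vtx q1); rewrite eq_sym.
by exists (vtx (ltnW q1)).
Qed.

Section Strong.
Variable Xs : seq {set 'I_n}.
Hypothesis strong : arc_strong k (inv_family hard_digraph Xs).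

(** At least [k] arcs leave [v], but the core has only [k - 1] vertices to receive them. *)
Lemma base_out (v : 'I_n) : v < q ->
  exists2 y : 'I_n, y < q & inv_family hard_digraph Xs v y.
Proof.
move=> vq; have := @strong [set v].
have [y yv] := exists_neq v.
move=> /(_ _ _)/wrap[]; first by apply/set0Pn; exists v; rewrite inE.
  by apply/set0Pn; exists y; rewrite !inE.
move=> kle.
case: (pickP (fun y : 'I_n => (y < q) && inv_family hard_digraph Xs v y)).
  by move=> w /andP[]; exists w.
move=> none.
suff : narcs (inv_family hard_digraph Xs) [set v] (~: [set v]) <= k - 1.
  by move=> /(leq_trans kle); move: k_gt0; clear; lia.
rewrite -card_core /narcs -(card_in_imset (f := snd)).
  apply/subset_leq_card/subsetP => _ /imsetP[[u w] + ->]; rewrite !inE /=.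
  case/and3P => vw /eqP uv _; rewrite leqNgt; apply/negP => wq.
  by have := none w; rewrite wq -uv vw.
move=> [u w] [u' w']; rewrite !inE /=.
by move=> /and3P[_ /eqP -> _] /and3P[_ /eqP -> _] ->.
Qed.

Lemma base_in (v : 'I_n) : v < q ->
  exists2 y : 'I_n, y < q & inv_family hard_digraph Xs y v.
Proof.
move=> vq; have := @strong (~: [set v]).
have [y yv] := exists_neq v.
rewrite setCK.
move=> /(_ _ _)/wrap[]; first by apply/set0Pn; exists y; rewrite !inE.
  by apply/set0Pn; exists v; rewrite inE.
move=> kle.
case: (pickP (fun y : 'I_n => (y < q) && inv_family hard_digraph Xs y v)).
  by move=> w /andP[]; exists w.
move=> none.
suff : narcs (inv_family hard_digraph Xs) (~: [set v]) [set v] <= k - 1.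
  by move=> /(leq_trans kle); move: k_gt0; clear; lia.
rewrite -card_core /narcs -(card_in_imset (f := fst)).
  apply/subset_leq_card/subsetP => _ /imsetP[[u w] + ->]; rewrite !inE /=.
  case/and3P => vw _ /eqP uv; rewrite leqNgt; apply/negP => wq.
  by have := none u; rewrite wq -uv vw.
move=> [u w] [u' w']; rewrite !inE /=.
by move=> /and3P[_ _ /eqP ->] /and3P[_ _ /eqP ->] ->.
Qed.

Definition membership (v : 'I_n) : (size Xs).-tuple bool :=
  map_tuple (fun X : {set 'I_n} => v \in X) (in_tuple Xs).

Lemma membership_eq u v w : membership u = membership v ->
  count (fun X : {set 'I_n} => (u \in X) && (w \in X)) Xs =
  count (fun X : {set 'I_n} => (v \in X) && (w \in X)) Xs.
Proof.
move=> /(congr1 val) /= /eq_in_map e; apply: eq_in_count => X /e ->.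
by [].
Qed.

Lemma hard_inversion_size : q <= 4 ^ size Xs.
Proof.
(* For [q = 3] only the empty family has to be excluded: vertex 2 is a sink of the triangle. *)
have [q3|q3] := eqVneq q 3.
  rewrite q3; case eXs: (size Xs) => [|s]; last first.
    by rewrite expnS; have := expn_gt0 4 s; lia.
  have [y yq] := base_out (v := vtx q_gt2) q_gt2.
  rewrite /inv_family (size0nil eXs) /= hard_baseE ?q_gt2 //=.
  by rewrite /base_arc q3 eqxx => ylt; rewrite q3 ltnNge ylt in yq.
have m_gt1 : 1 < m by case: m_big => // e; rewrite e eqxx in q3.
have m_le : m <= q by nia.
have no_arc (u v : 'I_n) : u < q -> v < m -> hard_digraph u v = false.
  move=> uq vm; rewrite hard_baseE ?(leq_trans vm m_le) // /base_arc (negbTE q3).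
  by rewrite (leqNgt m) vm !andbF.
pose V (i : 'I_m) := vtx (leq_trans (ltn_ord i) m_le).
(* The value at [None], the empty subfamily, improves the count from [m] to [m.+1], as [q_sqr]
   requires. *)
pose f (o : option 'I_m) : (size Xs).-tuple bool :=
  if o is Some i then membership (V i) else [tuple false | i < size Xs].
have nonzero i : f (Some i) <> f None.
  move=> /(congr1 val) /= e; have Vq : V i < q := leq_trans (ltn_ord i) m_le.
  have [y yq] := base_in Vq; rewrite /inv_family (no_arc y (V i) yq (ltn_ord i)).
  suff -> : count (fun X : {set 'I_n} => (y \in X) && (V i \in X)) Xs = 0 by [].
  apply/eqP; rewrite -leqn0 leqNgt -has_count; apply/hasPn => X XXs.
  rewrite negb_and; apply/orP; right; apply/negP => VX.
  have : true \in [seq V i \in (X : {set 'I_n}) | X <- Xs].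
    by rewrite -VX; apply: (map_f (fun X : {set 'I_n} => V i \in X)).
  by rewrite e => /mapP[].
have inj (i j : 'I_m) : i < j -> f (Some i) <> f (Some j).
  move=> ij; rewrite /f => /membership_eq e.
  have wq : j * m + i < q by have := ltn_ord i; have := ltn_ord j; nia.
  have mw : m <= j * m + i by nia.
  pose w := vtx wq.
  have arcP (y : 'I_n) : y < q -> hard_digraph y w -> y = V i \/ y = V j.
    move=> yq; rewrite hard_baseE // /base_arc (negbTE q3) attached_pair //.
    by case/and3P => _ _ /orP[/eqP|/eqP] h; [left|right]; apply: val_inj.
  have no_out (y : 'I_n) : y < q -> hard_digraph w y = false.
    move=> yq; rewrite hard_baseE // /base_arc (negbTE q3) /= ltnNge mw.
    by [].
  (* As [w] is a sink of the base, its new in-arc is an unreversed arc (even count) and its new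
     out-arc a reversed one (odd count). Equal memberships of [V i] and [V j] would make the two
     counts equal. *)
  have [y yq] := base_in (v := w) wq; rewrite /inv_family no_out //.
  case: ifP => // oy /(arcP y yq) yE.
  have [x xq] := base_out (v := w) wq; rewrite /inv_family no_out //.
  case: ifP => // ox /(arcP x xq) xE.
  have cC : count (fun X : {set 'I_n} => (w \in X) && (x \in X)) Xs =
            count (fun X : {set 'I_n} => (x \in X) && (w \in X)) Xs.
    by apply: eq_count => X; rewrite andbC.
  by move: oy ox; rewrite cC; case: xE => ->; case: yE => ->; rewrite ?e => ->.
have f_inj : injective f.
  move=> [i|] [j|] // e.
  - case: (ltngtP i j) => [/inj//|/inj h|/val_inj -> //]; by case: h.
  - by case: (nonzero i).
  - by case: (nonzero j).
have := leq_card f f_inj; rewrite card_option card_ord card_tuple card_bool => le.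
apply: leq_trans (ltnW q_sqr) _; rewrite -[4]/(2 * 2) expnMn; exact: leq_mul.
Qed.
End Strong.
End LowerBound.

(** * Extremal values and logarithms *)

Lemma nat_minimum (P : nat -> Prop) : (exists n, P n) ->
  exists2 m, P m & forall n, P n -> m <= n.
Proof.
case=> n; elim/ltn_ind: n => n IH Pn.
case: (classic (exists2 m, m < n & P m)) => [[m mn Pm]|none]; first exact: IH mn Pm.
exists n => // m Pm; rewrite leqNgt; apply/negP => mn; apply: none; by exists m.
Qed.

Lemma nat_maximum (P : nat -> Prop) b : (exists n, P n) ->
    (forall n, P n -> n <= b) ->
  exists2 m, P m & forall n, P n -> n <= m.
Proof.
move=> exP; elim: b => [|b IH] leb; first by case: exP => n Pn; exists n => // i Pi;
  exact: leq_trans (leb i Pi) (leq0n n).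
case: (classic (P b.+1)) => [Pb|nPb]; first by exists b.+1.
apply: IH => n Pn; have := leb n Pn; rewrite leq_eqVlt => /orP[/eqP e|//].
by case: nPb; rewrite -e.
Qed.

Lemma exists_sinv n k (D : rel 'I_n) : 0 < k -> k + 2 <= n -> loopless D ->
    edge_connected (2 * k) D ->
  exists t, is_sinv_digraph k D t.
Proof.
move=> k_gt0 kn D_irr conD.
have [Xs [_ strongXs]] := upper_bound k_gt0 kn D_irr conD.
have [|t [Ys [sYs strongYs]] min_t] := @nat_minimum (fun t =>
    exists Xs : seq {set 'I_n}, size Xs = t /\ arc_strong k (inv_family D Xs)).
  by exists (size Xs), Xs.
exists t.
by split; [exists Ys | move=> Zs strongZs; apply: min_t; exists Zs].
Qed.

Lemma exists_hard_digraph n k : 0 < k -> k + 2 <= n ->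
  exists D : rel 'I_n, [/\ loopless D, edge_connected (2 * k) D &
    forall Xs, arc_strong k (inv_family D Xs) -> n - k + 1 <= 4 ^ size Xs].
Proof.
move=> k_gt0 kn; set q := n - k + 1; have q_ge3 : 2 < q by rewrite /q; lia.
have [||m m_sqr max_m] := @nat_maximum (fun m => m * m <= q) q.
- by exists 0.
- by case=> // m; nia.
have q_sqr : q < m.+1 * m.+1.
  by rewrite ltnNge; apply/negP => /max_m; rewrite ltnn.
have m_big : q = 3 \/ 1 < m.
  by case: (ltnP 3 q) => h; [right; apply: max_m; lia | left; lia].
exists (@hard_digraph n k m); split.
- exact: hard_loopless.
- exact: hard_edge_connected.
- by move=> Xs; apply: hard_inversion_size.
Qed.

Lemma ln2_gt0 : Rlt 0 (ln 2).
Proof. by rewrite -ln_1; apply: ln_increasing; lra. Qed.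

Lemma ln_exp2 s : ln (INR (2 ^ s)) = Rmult (INR s) (ln 2).
Proof.
have -> : INR (2 ^ s) = pow 2 s.
  elim: s => [//|s IH]; rewrite expnS mult_INR IH /=; ring.
by rewrite ln_pow //; lra.
Qed.

Lemma ln_le_INR a b : 0 < a -> a <= b -> Rle (ln (INR a)) (ln (INR b)).
Proof.
move=> a0 /leP /le_INR [lt|->]; last by right.
by left; apply: ln_increasing lt; apply: lt_0_INR; apply/ltP.
Qed.

Theorem theorem1p1 (k n : nat) (hk : 0 < k) (hn : k + 2 <= n) :
  exists s : nat, is_sinv_order k n s /\
    Rle (Rdiv (log2 (INR (n - k + 1))) (IZR 2%Z)) (INR s) /\
    Rle (INR s) (Rminus (Rplus (log2 (INR n)) (Rmult (IZR 4%Z) (INR k))) (IZR 3%Z)).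
Proof.
pose b := trunc_log 2 n + 4 * k - 3.
pose P t := exists D : rel 'I_n,
  loopless D /\ edge_connected (2 * k) D /\ is_sinv_digraph k D t.
have leb t : P t -> t <= b.
  case=> D [D_irr [conD [_ min_t]]].
  by have [Xs [sXs strongXs]] := upper_bound hk hn D_irr conD; rewrite /b -sXs;
    apply: min_t.
have [D0 [D0_irr conD0 hardD0]] := exists_hard_digraph hk hn.
have [t0 sinv0] := exists_sinv hk hn D0_irr conD0.
have Pt0 : P t0 by exists D0.
have [|s Ps max_s] := @nat_maximum P b _ leb; first by exists t0.
exists s; split; [split=> [D D_irr conD|//] | split].
- have [t sinvt] := exists_sinv hk hn D_irr conD.
  by exists t; split=> //; apply: max_s; exists D.
(* Since [4 ^ t0 = 2 ^ (2 * t0)], the logarithm is bounded by [2 * s], whence the factor one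
   half. *)
- have q_le : n - k + 1 <= 2 ^ (s + s).
    have [[Xs [sXs strongXs]] _] := sinv0.
    apply: leq_trans (hardD0 Xs strongXs) _; rewrite sXs addnn -mul2n expnM.
    by rewrite leq_exp2l // max_s.
  have q_gt0 : 0 < n - k + 1 by rewrite addn1.
  have := ln_le_INR q_gt0 q_le; rewrite ln_exp2 (plus_INR s s) /log2 => h.
  have l2 := ln2_gt0; apply: (Rmult_le_reg_r (ln 2)) => //.
  have divK L : Rmult (Rdiv (Rdiv L (ln 2)) 2) (ln 2) = Rdiv L 2 by field; lra.
  by rewrite divK; lra.
- have n_gt0 : 0 < n by lia.
  have pow_le : 2 ^ trunc_log 2 n <= n by apply: trunc_logP.
  have p_gt0 : 0 < 2 ^ trunc_log 2 n by rewrite expn_gt0.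
  have := ln_le_INR p_gt0 pow_le; rewrite ln_exp2 /log2 => h.
  have l2 := ln2_gt0.
  have h2 : Rle (INR (trunc_log 2 n)) (Rdiv (ln (INR n)) (ln 2)).
    apply: (Rmult_le_reg_r (ln 2)) => //; rewrite /Rdiv Rmult_assoc Rinv_l; lra.
  (* The 3 is moved across before passing to reals because subtraction in [b] is truncated; nothing
     is lost, as [4 * k] exceeds 3. *)
  have : s + 3 <= trunc_log 2 n + 4 * k by have := leb s Ps; rewrite /b; lia.
  move=> /leP /le_INR; rewrite (plus_INR s 3) (plus_INR (trunc_log 2 n) (4 * k)).
  by rewrite (mult_INR 4 k) /=; lra.
Qed.
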